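(* Let $R$ be a stretched Artinian Gorenstein (commutative Noetherian) local ring. Then the following are equivalent. (1) $R$ is an Artinian hypersurface. (2) $\operatorname{mod} R$ has only trivial extension-closed subcategories.
   Context: $\mathfrak m$ denotes the maximal ideal of $R$, $\ell(R)$ the length of $R$ as an $R$-module, and $\operatorname{edim} R$ the embedding dimension, i.e. the minimal number of generators of $\mathfrak m$. An Artinian local ring $R$ is stretched if $\mathfrak m^{\ell(R)-\operatorname{edim} R}\ne 0$. An Artinian hypersurface is an Artinian local ring that is a hypersurface; equivalently, a ring isomorphic to $S/(x^n)$ for some discrete valuation ring $S$ with maximal ideal $(x)$ and some integer $n\ge 1$. $\operatorname{mod} R$ is the category of finitely generated $R$-modules. A subcategory of $\operatorname{mod} R$ always means a nonempty full subcategory closed under isomorphism. A subcategory is extension-closed if it is closed under direct summands and closed under extensions (for every exact sequence $0\to L\to M\to N\to 0$ in $\operatorname{mod} R$ with $L,N$ in the subcategory, $M$ is also in it). The trivial extension-closed subcategories are: the one consisting of zero modules, the one consisting of all finitely generated free $R$-modules, and $\operatorname{mod} R$ itself. $\operatorname{mod} R$ has only trivial extension-closed subcategories if every extension-closed subcategory is one of these three. *)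

(* Defs.v *)
From mathcomp Require Import all_boot all_algebra.
From mathcomp Require Import boolp classical_sets.

Set Implicit Arguments.
Unset Strict Implicit.
Unset Printing Implicit Defensive.

Import GRing.Theory.
Local Open Scope classical_set_scope.
Local Open Scope ring_scope.

Section Submodules.
Variables (R : comNzRingType) (M : lmodType R).

Definition submodule (N : set M) : Prop := submod_closed (mem N).

Definition span (A : set M) : set M := smallest submodule A.

Definition generated_by (N : set M) (n : nat) : Prop :=
  exists g : 'I_n -> M, span (range g) = N.

Definition min_generators (N : set M) (n : nat) : Prop :=
  generated_by N n /\ forall k, generated_by N k -> (n <= k)%N.

Definition fin_gen : Prop := exists n, generated_by setT n.

(* A strict chain N 0 < N 1 < ... < N n has length n. *)
Definition submodule_chain (n : nat) (N : nat -> set M) : Prop :=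
  (forall i, (i <= n)%N -> submodule (N i)) /\
  (forall i, (i < n)%N -> N i `<` N i.+1).

(* M has finite length n: n is the largest length of a strict chain. *)
Definition has_length (n : nat) : Prop :=
  (exists N, submodule_chain n N) /\
  (forall k N, submodule_chain k N -> (k <= n)%N).

End Submodules.

Arguments fin_gen {R} M.
Arguments has_length {R} M n.

Section Rings.
Variable R : comNzRingType.

Definition ideal (I : set R) : Prop := @submodule R R^o I.

Definition ideal_gen (A : set R) : set R := @span R R^o A.

Definition ideal_mul (I J : set R) : set R :=
  ideal_gen [set a * b | a in I & b in J].

Definition ideal_exp (I : set R) (n : nat) : set R :=
  iter n (ideal_mul I) setT.

Definition maximal_ideal (I : set R) : Prop :=
  [/\ ideal I, I <> setT &
      forall J, ideal J -> I `<=` J -> J = I \/ J = setT].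

Definition local_ring (m : set R) : Prop :=
  forall I, maximal_ideal I <-> I = m.

Definition noetherian : Prop :=
  forall I, ideal I -> exists n, @generated_by R R^o I n.

Definition artinian : Prop :=
  forall I : nat -> set R, (forall n, ideal (I n)) ->
    (forall n, I n.+1 `<=` I n) ->
    exists n, forall k, (n <= k)%N -> I k = I n.

(* l and e are uniquely determined by R and m. When (R, m) is Artinian local
   they exist and e < l, so the natural-number subtraction does not truncate. *)
Definition stretched (m : set R) : Prop :=
  exists l e, [/\ has_length R^o l, @min_generators R R^o m e &
                  ideal_exp m (l - e) <> [set 0]].

End Rings.

Arguments noetherian R : clear implicits.
Arguments artinian R : clear implicits.

Section Modules.
Variable R : comNzRingType.
Implicit Types L M N : lmodType R.

Definition isomorphic M N : Prop := exists f : {linear M -> N}, bijective f.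

Definition short_exact L M N (f : {linear L -> M}) (g : {linear M -> N}) : Prop :=
  [/\ injective f, range f = g @^-1` [set 0] & range g = setT].

Definition injective_module M : Prop :=
  forall (A B : lmodType R) (i : {linear A -> B}) (f : {linear A -> M}),
    injective i -> exists h : {linear B -> M}, forall a, h (i a) = f a.

(* M has an injective resolution 0 -> M -> I_0 -> ... -> I_n -> 0, cut into
   short exact sequences at the successive cosyzygies. *)
Fixpoint injdim_le (n : nat) M : Prop :=
  if n is n'.+1 then
    exists (I C : lmodType R) (f : {linear M -> I}) (g : {linear I -> C}),
      [/\ short_exact f g, injective_module I & injdim_le n' C]
  else injective_module M.

(* Gorenstein property of a (Noetherian) local ring. *)
Definition gorenstein : Prop := exists n, injdim_le n R^o.

Definition fin_free M : Prop := exists n, isomorphic M 'rV[R]_n.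

(* Nonempty full subcategories of mod R closed under isomorphism, given by
   their objects. *)
Definition subcategory (X : lmodType R -> Prop) : Prop :=
  [/\ forall M, X M -> fin_gen M,
      exists M, X M &
      forall M N, isomorphic M N -> X M -> X N].

Definition summand_closed (X : lmodType R -> Prop) : Prop :=
  forall M N, X (M * N)%type -> X M /\ X N.

Definition extension_closed (X : lmodType R -> Prop) : Prop :=
  [/\ subcategory X, summand_closed X &
      forall L M N (f : {linear L -> M}) (g : {linear M -> N}),
        fin_gen M -> short_exact f g -> X L -> X N -> X M].

Definition only_trivial_extension_closed : Prop :=
  forall X, extension_closed X ->
    [\/ forall M, X M <-> (forall x : M, x = 0),
        forall M, X M <-> fin_free M |
        forall M, X M <-> fin_gen M].

End Modules.

Arguments gorenstein R : clear implicits.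
Arguments only_trivial_extension_closed R : clear implicits.

(* S is a local principal ideal domain with nonzero maximal ideal n. *)
Definition dvr (S : idomainType) (n : set S) : Prop :=
  [/\ forall I : set S, ideal I -> exists a, I = ideal_gen [set a],
      local_ring n & n <> [set 0]].

(* R is isomorphic to S/(x^n), given as a surjection S -> R with kernel (x^n). *)
Definition artinian_hypersurface (R : comNzRingType) : Prop :=
  exists (S : idomainType) (x : S) (n : nat) (phi : {rmorphism S -> R}),
    [/\ dvr (ideal_gen [set x]), (1 <= n)%N, range phi = setT &
        phi @^-1` [set 0] = ideal_gen [set x ^+ n]].

(* Main.v *)
From HB Require Import structures.
From mathcomp Require Import all_boot all_algebra.
From mathcomp Require Import boolp classical_sets functions.
From mathcomp Require Import ring zify.
Require Import Defs.

Set Implicit Arguments.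
Unset Strict Implicit.
Unset Printing Implicit Defensive.

Import GRing.Theory.
Local Open Scope classical_set_scope.
Local Open Scope ring_scope.

(* If [R = S/(x^n)], every finitely generated module is a direct sum of modules
   [R/x^i]; an extension-closed subcategory containing one with [0 < i < n]
   contains [R/x] by the sequences
   [0 -> R/x^i -> R/x^(i+1) + R/x^(i-1) -> R/x^i -> 0], hence contains everything.

   Conversely, let [m] be the maximal ideal of [R].  As [R] is stretched, [m^2] is
   principal; if [m] is not, there is [w] in [m \ m^2] with [w m^2 = 0], and the
   socle of [R], which is simple because [R] is Gorenstein, is [w m].  Then
   [{M | Tor_1(M, R/w) = 0}] is extension-closed, contains [R] and the nonfree
   module [R z] for a suitable [z] in [m], but not the residue field.  So [m = (x)].

   It remains to write [R] as a quotient of a discrete valuation ring.  Consider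
   subrings [G] of a large field with a morphism [G -> R] and an element [X] of [G]
   mapped to [x].  If [X] and [a] form a regular sequence generating the preimage of
   [m], then adjoining [a / X] yields a ring with special fibre [k[y]]; the preimage
   of [m] in it is again generated by [X] and at most one more element, a lift of the
   minimal polynomial of [y].  In the union of the infinite iteration [X] generates
   the preimage of [m], and transcendental elements can be added until [G -> R] is
   onto. *)

(** * Subrings and polynomials with coefficients in them *)

(** Mixed characteristic shapes the lifting: the natural source [Z[X]] has dimension two, and a
    residue characteristic [p] need not be a multiple of [X] in it. Repeated blowing up repairs this
    without any topological completeness. The ring obtained is a domain, but some nonzero elements
    may be divisible by every power of [X]; they are killed at the end, harmlessly since [x] is
    nilpotent. Every [r] in [R] gets a variable of its own, and enlargements must not use up
    variables still waiting: this is why subfields omitting one variable are carried along.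
    Gorenstein is given as finite injective dimension, whereas the argument uses that [R] is
    injective over itself; hence the passage through Baer's criterion. It yields both the simple
    socle and the double annihilator property, and the latter is why the module [R z] is chosen with
    [w] outside [R z]. *)

Section Subrings.
Variable W : comNzRingType.
Implicit Types (A : set W) (F : {poly W}).

Definition subring A : Prop :=
  [/\ A 1, forall a b, A a -> A b -> A (a - b) &
      forall a b, A a -> A b -> A (a * b)].

Definition coefs_in A : set {poly W} := [set F | forall i, A F`_i].

Definition adjoin A (z : W) : set W := [set F.[z] | F in coefs_in A].

Definition multiples (x : W) A : set W := [set x * a | a in A].

Variables (A : set W) (Aring : subring A).

Lemma subring1 : A 1. Proof. by case: Aring. Qed.

Lemma subringB a b : A a -> A b -> A (a - b). Proof. by case: Aring => _ + _; apply. Qed.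

Lemma subringM a b : A a -> A b -> A (a * b). Proof. by case: Aring => _ _; apply. Qed.

Lemma subring0 : A 0. Proof. by rewrite -(subrr 1); apply: subringB; apply: subring1. Qed.

Lemma subringN a : A a -> A (- a).
Proof. by move=> Aa; rewrite -sub0r; apply: subringB => //; apply: subring0. Qed.

Lemma subringD a b : A a -> A b -> A (a + b).
Proof. by move=> Aa Ab; rewrite -[b]opprK; apply: subringB => //; apply: subringN. Qed.

Lemma subring_sum (I : Type) (r : seq I) (P : pred I) (f : I -> W) :
  (forall i, P i -> A (f i)) -> A (\sum_(i <- r | P i) f i).
Proof. by move=> Af; elim/big_ind: _ => //; [apply: subring0 | apply: subringD]. Qed.

Lemma subringX a n : A a -> A (a ^+ n).
Proof.
move=> Aa; elim: n => [|n IHn]; first by rewrite expr0; apply: subring1.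
by rewrite exprS; apply: subringM.
Qed.

Lemma subring_int (k : int) : A k%:~R.
Proof.
have An (n : nat) : A n%:R.
  by elim: n => [|n IHn]; [apply: subring0 | rewrite mulrS; apply: subringD => //; apply: subring1].
by case: k => n; [|rewrite NegzE rmorphN; apply: subringN]; apply: An.
Qed.

Lemma coefs_inC a : A a -> coefs_in A a%:P.
Proof. by move=> Aa i; rewrite coefC; case: eqP => // _; apply: subring0. Qed.

Lemma coefs_inXn n : coefs_in A 'X^n.
Proof. by move=> i; rewrite coefXn; case: eqP => _; [apply: subring1 | apply: subring0]. Qed.

Lemma coefs_in_subringB F1 F2 : coefs_in A F1 -> coefs_in A F2 -> coefs_in A (F1 - F2).
Proof. by move=> A1 A2 i; rewrite coefB; apply: subringB. Qed.

Lemma coefs_in_subringD F1 F2 : coefs_in A F1 -> coefs_in A F2 -> coefs_in A (F1 + F2).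
Proof. by move=> A1 A2 i; rewrite coefD; apply: subringD. Qed.

Lemma coefs_in_subringM F1 F2 : coefs_in A F1 -> coefs_in A F2 -> coefs_in A (F1 * F2).
Proof.
by move=> A1 A2 i; rewrite coefM; apply: subring_sum => j _; apply: subringM.
Qed.

Lemma coefs_in_monom a n : A a -> coefs_in A (a%:P * 'X^n).
Proof. by move=> Aa; apply: coefs_in_subringM; [apply: coefs_inC | apply: coefs_inXn]. Qed.

Lemma subring_horner F z : coefs_in A F -> A z -> A F.[z].
Proof.
move=> AF Az; rewrite horner_coef; apply: subring_sum => i _.
by apply: subringM => //; apply: subringX.
Qed.

Lemma adjoin_subring z : subring (adjoin A z).
Proof.
split.
- by exists 1%:P; [apply: coefs_inC; apply: subring1 | rewrite hornerC].
- move=> _ _ [F1 A1 <-] [F2 A2 <-]; exists (F1 - F2); last by rewrite hornerD hornerN.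
  exact: coefs_in_subringB.
- move=> _ _ [F1 A1 <-] [F2 A2 <-]; exists (F1 * F2); last by rewrite hornerM.
  exact: coefs_in_subringM.
Qed.

Lemma sub_adjoin z : A `<=` adjoin A z.
Proof. by move=> a Aa; exists a%:P; [apply: coefs_inC | rewrite hornerC]. Qed.

Lemma mem_adjoin z : adjoin A z z.
Proof. by exists 'X; [rewrite -['X]expr1; apply: coefs_inXn | rewrite hornerX]. Qed.

Lemma multiplesD x a b : multiples x A a -> multiples x A b -> multiples x A (a + b).
Proof. by move=> [c Ac <-] [d Ad <-]; exists (c + d); [apply: subringD | rewrite mulrDr]. Qed.

Lemma multiplesB x a b : multiples x A a -> multiples x A b -> multiples x A (a - b).
Proof. by move=> [c Ac <-] [d Ad <-]; exists (c - d); [apply: subringB | rewrite mulrBr]. Qed.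

Lemma multiplesMl x a b : A a -> multiples x A b -> multiples x A (a * b).
Proof. by move=> Aa [d Ad <-]; exists (a * d); [apply: subringM | rewrite mulrCA]. Qed.

Lemma multiples0 x : multiples x A 0.
Proof. by exists 0; [apply: subring0 | rewrite mulr0]. Qed.

Lemma multiples_sum x (I : Type) (r : seq I) (P : pred I) (f : I -> W) :
  (forall i, P i -> multiples x A (f i)) -> multiples x A (\sum_(i <- r | P i) f i).
Proof. by move=> Af; elim/big_ind: _ => //; [apply: multiples0 | apply: multiplesD]. Qed.

Lemma multiples_horner x F z : A z -> coefs_in (multiples x A) F -> multiples x A F.[z].
Proof.
move=> Az AF; rewrite horner_coef; apply: multiples_sum => i _.
by rewrite mulrC; apply: multiplesMl => //; apply: subringX.
Qed.

End Subrings.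

Lemma adjoin_sub (W : comNzRingType) (A B : set W) z :
  subring B -> A `<=` B -> B z -> adjoin A z `<=` B.
Proof. by move=> Bring AB Bz _ [F AF <-]; apply: subring_horner => // i; apply/AB/AF. Qed.

Lemma coefs_in_split (W : comNzRingType) (A B : set W) (x : W) (F : {poly W}) :
  subring A -> subring B -> coefs_in [set a + x * b | a in A & b in B] F ->
  exists F1 F2, [/\ coefs_in A F1, coefs_in B F2 & F = F1 + x%:P * F2].
Proof.
move=> Aring Bring FAB.
have /choice [f fP] : forall i, exists ab : W * W,
    [/\ A ab.1, B ab.2 & F`_i = ab.1 + x * ab.2].
  by move=> i; have [a Aa [b Bb <-]] := FAB i; exists (a, b).
exists (\poly_(i < size F) (f i).1), (\poly_(i < size F) (f i).2); split.
- by move=> i; rewrite coef_poly; case: ifP => _; [case: (fP i) | apply: subring0].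
- by move=> i; rewrite coef_poly; case: ifP => _; [case: (fP i) | apply: subring0].
apply/polyP => i; rewrite coefD coefCM !coef_poly; case: ltnP => [_|szi].
  by case: (fP i).
by rewrite nth_default // mulr0 addr0.
Qed.

(** Long division by a monic polynomial never divides by a coefficient, so everything stays over
    [A]. *)
Lemma monic_divide (W : comNzRingType) (A : set W) (P F : {poly W}) :
  subring A -> P \is monic -> coefs_in A P -> coefs_in A F ->
  exists Q T, [/\ coefs_in A Q, coefs_in A T, F = P * Q + T & (size T < size P)%N].
Proof.
move=> Aring Pmon AP; have [n] := ubnP (size F).
elim: n => // n IHn in F *; rewrite ltnS => szF AF.
have [ltFP|lePF] := ltnP (size F) (size P).
  by exists 0, F; rewrite mulr0 add0r; split => // i; rewrite coef0; apply: subring0.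
have P_gt0 : (0 < size P)%N by rewrite size_poly_gt0 monic_neq0.
pose M : {poly W} := (lead_coef F)%:P * 'X^(size F - size P).
have AM : coefs_in A M by apply: coefs_in_monom => //; apply: AF.
have [||Q [T [AQ AT FE ltT]]] := IHn (F - P * M).
- have F_gt0 : (0 < size F)%N by apply: leq_trans lePF.
  apply: leq_trans szF; rewrite -[X in (_ < X)%N](prednK F_gt0) ltnS; apply/leq_sizeP => j.
  rewrite leq_eqVlt => /predU1P[<-|ltj].
    rewrite coefB /M mulrCA coefCM coefMXn.
    have -> : ((size F).-1 < size F - size P)%N = false.
      by apply/negbTE; rewrite -leqNgt -ltnS prednK // ltn_subrL P_gt0.
    have -> : ((size F).-1 - (size F - size P) = (size P).-1)%N.
      by move: P_gt0 lePF; case: (size P) (size F) => // p [|q] //= _; lia.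
    by rewrite -!lead_coefE (monicP Pmon) mulr1 subrr.
  rewrite coefB nth_default; last by rewrite -(prednK F_gt0).
  rewrite /M mulrCA coefCM coefMXn; case: ifP => _; first by rewrite mulr0 subr0.
  rewrite nth_default ?mulr0 ?subr0 //.
  by move: P_gt0 lePF ltj F_gt0; case: (size P) (size F) => // p [|q] //= _; lia.
- by apply: coefs_in_subringB => //; apply: coefs_in_subringM.
exists (M + Q), T; split=> //; first exact: coefs_in_subringD.
by rewrite mulrDr -addrA -FE addrC subrK.
Qed.

Definition prime_ideal (W : comNzRingType) (I : set W) : Prop :=
  [/\ I 0, ~ I 1, forall a b, I a -> I b -> I (a - b),
      forall a b, I b -> I (a * b) & forall a b, I (a * b) -> I a \/ I b].

Lemma size_cancel_lead (W : nzRingType) (F : {poly W}) n :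
  (size F <= n.+1)%N -> (size (F - (F`_n)%:P * 'X^n)%R <= n)%N.
Proof.
move=> szF; apply/leq_sizeP => j; rewrite leq_eqVlt coefB coefCM coefXn.
case/predU1P => [<-|ltnj]; first by rewrite eqxx mulr1 subrr.
by rewrite gtn_eqF // mulr0 subr0 nth_default // (leq_trans szF).
Qed.

(** The leading coefficient of [P * F] is that of [F], so the leading term of [F] can be peeled off.
    With [I] the multiples of [X], a monic polynomial is thus a nonzerodivisor modulo [X]. *)
Lemma monic_coefs_in (W : comNzRingType) (A I : set W) (P F : {poly W}) :
  (forall a b, I a -> I b -> I (a - b)) -> (forall a b, A a -> I b -> I (a * b)) ->
  P \is monic -> coefs_in A P -> coefs_in I (P * F) -> coefs_in I F.
Proof.
move=> IB IM Pmon AP; have [n] := ubnP (size F).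
elim: n => // n IHn in F *; rewrite ltnS => szF IPF.
have I0 : I 0 by rewrite -(subrr (P * F)`_0); apply: IB.
have [F0|F_neq0] := eqVneq F 0; first by move=> i; rewrite F0 coef0.
have F_gt0 : (0 < size F)%N by rewrite size_poly_gt0.
have Ilead : I (lead_coef F) by rewrite -(lead_coef_monicM F Pmon); apply: IPF.
pose M := (lead_coef F)%:P * 'X^((size F).-1).
have IM' Q : coefs_in A Q -> coefs_in I (Q * M).
  move=> AQ i; rewrite /M mulrCA coefCM coefMXn.
  by case: ifP => _; rewrite ?mulr0 // mulrC; apply: IM.
have /IHn : coefs_in I (P * (F - M)) by move=> i; rewrite mulrBr coefB; apply: IB => //; apply: IM'.
have szFM : (size (F - M)%R < n)%N.
  apply: leq_trans szF; rewrite -[X in (_ < X)%N](prednK F_gt0) ltnS.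
  by rewrite /M lead_coefE size_cancel_lead // prednK.
move=> /(_ szFM) IFM i; rewrite -[F`_i](subrK M`_i) -coefB.
rewrite -[M`_i]opprK -[- M`_i]sub0r; apply: (IB) => //; apply: IB => //.
rewrite /M coefCM coefXn; case: eqP => _; rewrite ?mulr1 ?mulr0 //.
Qed.

(** * Blowing up and completing graphs of partial morphisms *)

Section Blowup.
Variables (W : comNzRingType) (nul inM : set W) (X : W).

(* [W] will be a product [L * R] with [L] a field, [nul] the elements [(0, r)]
   and [inM] the elements [(l, r)] with [r] in the maximal ideal of [R].  A
   [good] subring is then the graph of a morphism to [R] from a subring of
   [L].  All rings needed are obtained inside [W], by blowing up, localizing and
   taking unions. *)
Hypothesis nul_prime : prime_ideal nul.
Hypothesis inM_prime : prime_ideal inM.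
Hypothesis X_nul : ~ nul X.
Hypothesis X_inM : inM X.
Hypothesis inv_exists : forall s, ~ nul s -> ~ inM s -> exists t, s * t = 1.
Hypothesis divX : forall a, inM a -> exists z, X * z = a.
Implicit Types (G C E : set W) (F : {poly W}).

Definition good G : Prop :=
  [/\ subring G, G X & forall w, G w -> nul w -> w = 0].

Definition completed G : Prop := forall w, G w -> inM w -> multiples X G w.

Definition local_subring G : Prop :=
  forall w, G w -> ~ inM w -> exists2 v, G v & w * v = 1.

(* [X, a] is a regular sequence generating the maximal ideal [inM] of [G]. *)
Definition regular_pair G a : Prop :=
  [/\ G a, inM a, forall b, G b -> multiples X G (a * b) -> multiples X G b &
      forall w, G w -> inM w -> exists g h, [/\ G g, G h & w = X * g + a * h]].

Definition regular G : Prop := completed G \/ exists a, regular_pair G a.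

(* [G / X G] is the polynomial ring [k [y]] over the field [k = C / X G], which
   embeds in the residue field of [R]. *)
Record residual_line G C y : Prop := ResidualLine {
  line_subring : subring C;
  line_sub : C `<=` G;
  line_multiples : multiples X G `<=` C;
  line_gen : G = adjoin C y;
  line_inM : forall c, C c -> inM c -> multiples X G c;
  line_inv : forall c, C c -> ~ inM c -> exists2 d, C d & multiples X G (c * d - 1);
  line_free : forall F, coefs_in C F -> multiples X G F.[y] ->
    coefs_in (multiples X G) F }.

(** In the application [E] is the preimage of a subfield of [L]; it contains [a / X] as soon as it
    contains [a] and [X]. *)
Definition division_closed E : Prop :=
  forall s w, E s -> ~ nul s -> E (s * w) -> E w.

Let inMB a b : inM a -> inM b -> inM (a - b). Proof. by case: inM_prime => _ _ + _ _; apply. Qed.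
Let inMM a b : inM b -> inM (a * b). Proof. by case: inM_prime => _ _ _ + _; apply. Qed.
Let inM0 : inM 0. Proof. by case: inM_prime. Qed.
Let inMD a b : inM a -> inM b -> inM (a + b).
Proof. by move=> Ma Mb; rewrite -[b]opprK -[- b]sub0r; do 2?apply: inMB. Qed.
Let inM_1 : ~ inM 1. Proof. by case: inM_prime. Qed.
Let inMF a b : inM (a * b) -> inM a \/ inM b. Proof. by case: inM_prime => _ _ _ _; apply. Qed.
Let nulM a b : nul b -> nul (a * b). Proof. by case: nul_prime => _ _ _ + _; apply. Qed.
Let nulF a b : nul (a * b) -> nul a \/ nul b. Proof. by case: nul_prime => _ _ _ _; apply. Qed.
Let nul0 : nul 0. Proof. by case: nul_prime. Qed.

Lemma inM_multiples G : multiples X G `<=` inM.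
Proof. by move=> _ [g _ <-]; rewrite mulrC; apply: inMM. Qed.

Lemma good_mulX G b : good G -> G b -> X * b = 0 -> b = 0.
Proof. by move=> [_ _ G0] Gb Xb0; apply: G0 => //; case: (@nulF X b); rewrite ?Xb0. Qed.

Lemma good_neq0_nul G b : good G -> G b -> ~ inM b -> ~ nul b.
Proof. by move=> [_ _ G0] Gb Mb nb; apply: Mb; rewrite (G0 b). Qed.

(** The contraction of [inM] becomes an ideal of the principal ideal domain [G / X G = k[y]]. If it
    is zero, [G] is completed; otherwise a monic lift of its generator gives the second element of a
    regular pair. *)
Lemma line_regular G C y : good G -> residual_line G C y -> regular G.
Proof.
move=> [Gring GX G0] [Cring CG XC GE CM Cinv free].
have Gy : G y by rewrite GE; apply: mem_adjoin.
have XGN a b : multiples X G a -> multiples X G b -> multiples X G (a - b).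
  exact: multiplesB.
pose vanishing_poly F := coefs_in C F /\ inM F.[y].
have [triv|] := pselect (forall F, vanishing_poly F -> coefs_in inM F).
  left => w; rewrite {1}GE => -[F CF <-] Mw; apply: multiples_horner => // i.
  by apply: CM => //; apply: triv; split.
move=> /existsNP[F1 /not_implyP[F1v F1M]]; right.
pose P n := `[< exists F, [/\ vanishing_poly F, ~ coefs_in inM F & size F = n] >].
have exP : exists n, P n by exists (size F1); apply/asboolP; exists F1.
have [N /asboolP[F [[CF MF] FM szF]] minN] := ex_minnP exP.
have {}minN T : vanishing_poly T -> (size T < N)%N -> coefs_in inM T.
  move=> Tv; rewrite ltnNge => /negP szT; apply: contrapT => TM; apply: szT.
  by apply: minN; apply/asboolP; exists T.
have N_gt0 : (0 < N)%N.
  rewrite lt0n -szF size_poly_eq0; apply/eqP => F0; apply: FM => i.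
  by rewrite F0 coef0.
case: N szF minN N_gt0 => // D szF minN _.
(* Otherwise dropping the leading term leaves a shorter vanishing polynomial, whose coefficients,
   and then those of [F], all lie in [inM]. *)
have leadM : ~ inM F`_D.
  move=> cM; pose M := (F`_D)%:P * 'X^D.
  have /minN : vanishing_poly (F - M).
    split; first by apply: coefs_in_subringB => //; apply: coefs_in_monom.
    by rewrite hornerD hornerN /M hornerM hornerC; apply: inMB => //; rewrite mulrC; apply: inMM.
  rewrite ltnS size_cancel_lead ?szF // => /(_ isT) FMM; apply: FM => i.
  rewrite -[F`_i](subrK M`_i) -coefB; apply: inMD => //.
  by rewrite /M coefCM mulrC; apply: inMM.
have [d Cd Xd] := Cinv _ (CF D) leadM.
(* As [d] inverts the leading coefficient only modulo [X], the product must be corrected to be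
   monic; the correction has its coefficient in [X G], which [C] contains. *)
pose F2 := d%:P * F - (F`_D * d - 1)%:P * 'X^D.
have CF2 : coefs_in C F2.
  apply: coefs_in_subringB; first exact: Cring.
    by apply: coefs_in_subringM => //; apply: coefs_inC.
  by apply: coefs_in_monom => //; apply: XC.
have F2D : F2`_D = 1.
  by rewrite coefB !coefCM coefXn eqxx mulr1 [d * _]mulrC opprB addrC subrK.
have szF2 : size F2 = D.+1.
  apply/eqP; rewrite eqn_leq; apply/andP; split.
    apply/leq_sizeP => j ltDj; rewrite coefB !coefCM coefXn gtn_eqF // mulr0 subr0.
    by rewrite nth_default ?mulr0 // szF.
  rewrite ltnNge; apply/negP => /leq_sizeP/(_ D (leqnn _)); rewrite F2D.
  by apply/eqP; rewrite oner_eq0.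
have F2mon : F2 \is monic by rewrite monicE lead_coefE szF2 F2D.
have MF2 : inM F2.[y].
  rewrite hornerD hornerN !hornerM !hornerC; apply: inMB; first exact: inMM.
  by rewrite mulrC; apply: inMM; apply: inM_multiples Xd.
exists F2.[y]; split => //; first by rewrite GE; exists F2.
  move=> b; rewrite {1}GE => -[B CB <-]; rewrite -hornerM => XF2B.
  apply: multiples_horner => //.
  apply: monic_coefs_in F2mon (CF2) _ => //.
    by move=> a c Ca; apply: multiplesMl => //; apply: CG.
  by apply: free => //; exact: coefs_in_subringM.
move=> w; rewrite {1}GE => -[B CB <-] MB.
have [Q [T [CQ CT BE ltT]]] := monic_divide Cring F2mon CF2 CB.
(* The remainder is a vanishing polynomial shorter than [F], so all its coefficients lie in
   [inM]. *)
have : multiples X G T.[y].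
  apply: multiples_horner => // i; apply: CM => //; apply: minN; last by rewrite -szF2.
  split=> //; rewrite -[T](addKr (F2 * Q)) -BE hornerD hornerN hornerM addrC.
  by apply: inMB => //; rewrite mulrC; apply: inMM.
case=> g Gg gE; exists g, Q.[y]; split=> //; first by rewrite GE; exists Q.
by rewrite BE hornerD hornerM addrC gE.
Qed.

(** Serves both for adjoining [a / X] and for a free variable. By the last hypothesis all relations
    of [z] over [G] are trivial modulo [X], so the special fibre is [k[z]] with [k] the residue
    field of [G]; the set [C] is the preimage of [k]. *)
Lemma adjoin_residual_line G z : good G -> local_subring G ->
  (forall w, G w -> inM w -> multiples X (adjoin G z) w) ->
  (forall F, coefs_in G F -> nul F.[z] ->
     coefs_in (multiples X (adjoin G z)) F /\ F.[z] = 0) ->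
  good (adjoin G z) /\
  residual_line (adjoin G z) [set g + X * h | g in G & h in adjoin G z] z.
Proof.
move=> [Gring GX G0] Gloc GM rel; set G' := adjoin G z; set C := [set _ | _ in _ & _ in _].
have G'ring : subring G' by apply: adjoin_subring.
have GG' : G `<=` G' by apply: sub_adjoin.
have G'X : G' X by apply: GG'.
have XG' h : G' h -> multiples X G' (X * h) by exists h.
have Cring : subring C.
  split.
  - by exists 1; [apply: subring1 | exists 0; [apply: subring0 | rewrite mulr0 addr0]].
  - move=> _ _ [g1 Gg1 [h1 Gh1 <-]] [g2 Gg2 [h2 Gh2 <-]].
    exists (g1 - g2); first exact: subringB.
    by exists (h1 - h2); [apply: subringB | ring].
  - move=> _ _ [g1 Gg1 [h1 Gh1 <-]] [g2 Gg2 [h2 Gh2 <-]].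
    exists (g1 * g2); first exact: subringM.
    exists (g1 * h2 + g2 * h1 + X * (h1 * h2)); last by ring.
    do ?apply: subringD => //; do ?apply: subringM => //; exact: GG'.
split.
  by split=> // _ [F GF <-] /(rel _ GF)[].
have CG' : C `<=` G'.
  by move=> _ [g Gg [h G'h <-]]; apply: subringD => //; [apply: GG' | apply: subringM].
have GC : G `<=` C.
  by move=> g Gg; exists g => //; exists 0; [apply: subring0 | rewrite mulr0 addr0].
split=> //.
- move=> _ [h G'h <-]; exists 0; first exact: subring0.
  by exists h => //; rewrite add0r.
- apply/seteqP; split.
    by apply: adjoin_sub; [apply: adjoin_subring | move=> g /GC; apply: sub_adjoin | apply: mem_adjoin].
  by apply: adjoin_sub => //; apply: mem_adjoin.
- move=> _ [g Gg [h G'h <-]] Mgh; apply: multiplesD => //; last exact: XG'.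
  apply: GM => //; rewrite -[g](addrK (X * h)); apply: inMB => //.
  by rewrite mulrC; apply: inMM.
- move=> _ [g Gg [h G'h <-]] Mgh.
  have [v Gv gv1] : exists2 v, G v & g * v = 1.
    apply: Gloc => // Mg; apply: Mgh; apply: inMD => //.
    by rewrite mulrC; apply: inMM.
  exists v; first exact: GC.
  exists (h * v); first by apply: subringM => //; apply: GG'.
  by rewrite mulrDl gv1; ring.
move=> F CF [h [K GK <-]].
have [F1 [F2 [GF1 G'F2 ->]]] := coefs_in_split Gring G'ring CF.
rewrite hornerD hornerM hornerC => E.
(* [F2] has coefficients in [G'], but the value [K(z) - F2(z)] is again a polynomial in [z] over
   [G]. The congruence modulo [X] becomes an exact relation over [G], to which [rel] applies. *)
have [K2 GK2 K2E] : exists2 K2, coefs_in G K2 & K2.[z] = K.[z] - F2.[z].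
  have [K2 GK2 K2E] : G' (K.[z] - F2.[z]).
    by apply: subringB => //; [exists K | apply: subring_horner => //; apply: mem_adjoin].
  by exists K2.
have : (F1 - X%:P * K2).[z] = 0.
  by rewrite hornerD hornerN hornerM hornerC K2E mulrBr E; ring.
move=> F0; have [||rF _] := rel (F1 - X%:P * K2).
- by apply: coefs_in_subringB => //; apply: coefs_in_subringM => //; apply: coefs_inC.
- by rewrite F0.
move=> i; rewrite coefD coefCM -[F1`_i](subrK (X * K2`_i)) -addrA.
apply: multiplesD => //; first by move: (rF i); rewrite coefB coefCM.
by rewrite -mulrDr; apply: XG'; apply: subringD => //; apply: GG'.
Qed.

Definition localized G : set W :=
  [set w | exists s, [/\ G s, ~ inM s & G (s * w)]].

Lemma sub_localized G : good G -> G `<=` localized G.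
Proof. by move=> [Gring _ _] g Gg; exists 1; rewrite mul1r; split => //; apply: subring1. Qed.

Lemma localized_sub E G : good G -> division_closed E -> G `<=` E -> localized G `<=` E.
Proof.
by move=> Gg dE GE w [s [Gs Ms Gsw]]; apply: (dE s); [apply: GE| apply: good_neq0_nul Gg Gs Ms | apply: GE].
Qed.

Lemma good_localized G : good G -> good (localized G).
Proof.
move=> Gg; have [Gring GX G0] := Gg; split.
- split; first by apply: sub_localized => //; apply: subring1.
  - move=> a b [s [Gs Ms Gsa]] [t [Gt Mt Gtb]]; exists (s * t); split.
    + exact: subringM.
    + by move=> /inMF[].
    + have -> : s * t * (a - b) = t * (s * a) - s * (t * b) by ring.
      by apply: subringB => //; apply: subringM.
  - move=> a b [s [Gs Ms Gsa]] [t [Gt Mt Gtb]]; exists (s * t); split.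
    + exact: subringM.
    + by move=> /inMF[].
    + have -> : s * t * (a * b) = (s * a) * (t * b) by ring.
      exact: subringM.
- exact: sub_localized.
- move=> w [s [Gs Ms Gsw]] nw.
  have [t st1] := inv_exists (good_neq0_nul Gg Gs Ms) Ms.
  by rewrite -[w]mul1r -st1 [s * t]mulrC -mulrA (G0 (s * w)) ?mulr0 //; apply: nulM.
Qed.

Lemma local_localized G : good G -> local_subring (localized G).
Proof.
move=> Gg; have [Gring GX G0] := Gg; move=> w Lw Mw.
have Lg := good_localized Gg.
have [v wv1] := inv_exists (good_neq0_nul Lg Lw Mw) Mw.
case: Lw => s [Gs Ms Gsw]; exists v => //; exists (s * w); split => //.
  by move=> /inMF[].
by rewrite -mulrA wv1 mulr1.
Qed.

Lemma completed_localized G : good G -> completed G -> completed (localized G).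
Proof.
move=> Gg; have [Gring GX G0] := Gg; move=> cG w [s [Gs Ms Gsw]] Mw.
have [t st1] := inv_exists (good_neq0_nul Gg Gs Ms) Ms.
have [g Gg' gE] := cG _ Gsw (inMM s Mw).
exists (t * g); last by rewrite mulrCA gE mulrA [t * s]mulrC st1 mul1r.
by exists s; rewrite mulrA st1 mul1r.
Qed.

Lemma regular_pair_localized G a :
  good G -> regular_pair G a -> regular_pair (localized G) a.
Proof.
move=> Gg; have [Gring GX G0] := Gg => -[Ga Ma areg agen]; split => //.
- exact: sub_localized.
- move=> b [s [Gs Ms Gsb]] [h [t [Gt Mt Gth]] hE].
  have [s' ss1] := inv_exists (good_neq0_nul Gg Gs Ms) Ms.
  have [t' tt1] := inv_exists (good_neq0_nul Gg Gt Mt) Mt.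
  have [||g Gg' gE] := areg (t * (s * b)); first exact: subringM.
    exists (s * (t * h)); first exact: subringM.
    by have -> : X * (s * (t * h)) = s * t * (X * h); [ring | rewrite hE; ring].
  exists (s' * t' * g).
    exists (s * t); split; [exact: subringM | by move=> /inMF[] |].
    have -> : s * t * (s' * t' * g) = (s * s') * (t * t') * g by ring.
    by rewrite ss1 tt1 !mul1r.
  have -> : X * (s' * t' * g) = s' * t' * (X * g) by ring.
  rewrite gE; have -> : s' * t' * (t * (s * b)) = (s * s') * (t * t') * b by ring.
  by rewrite ss1 tt1 !mul1r.
- move=> w [s [Gs Ms Gsw]] Mw.
  have [s' ss1] := inv_exists (good_neq0_nul Gg Gs Ms) Ms.
  have [g [h [Gg' Gh E]]] := agen _ Gsw (inMM s Mw).
  exists (s' * g), (s' * h); split.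
  + by exists s; rewrite mulrA ss1 mul1r.
  + by exists s; rewrite mulrA ss1 mul1r.
  + have -> : X * (s' * g) + a * (s' * h) = s' * (X * g + a * h) by ring.
    by rewrite -E mulrA [s' * s]mulrC ss1 mul1r.
Qed.

Definition tracks G G' : Prop :=
  forall E, subring E -> division_closed E -> G `<=` E -> G' `<=` E.

(* If [X z = a], the kernel of [G[T] -> W, T |-> z] is generated by [X T - a]. *)
Lemma blowup_kernel G a z F : good G -> regular_pair G a -> X * z = a ->
  coefs_in G F -> nul F.[z] ->
  exists2 Q, coefs_in G Q & F = (X%:P * 'X - a%:P) * Q.
Proof.
move=> Gg [Ga Ma areg _] Xz; have [Gring GX G0] := Gg.
have [n] := ubnP (size F); elim: n => // n IHn in F *; rewrite ltnS => szF GF nF.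
have [F0|F_neq0] := eqVneq F 0.
  by exists 0; [move=> i; rewrite coef0; apply: subring0 | rewrite mulr0].
have F_gt0 : (0 < size F)%N by rewrite size_poly_gt0.
pose D := (size F).-1; have szFD : size F = D.+1 by rewrite prednK.
have {}F_neq0 : F`_D != 0 by rewrite -lead_coefE lead_coef_eq0.
(* Clearing denominators: [X^D F(z)] is zero and congruent to [F_D a^D] modulo [X G]. Regularity of
   [a] modulo [X] then makes [F_D] a multiple of [X]. *)
have XD : X ^+ D * F.[z] = F`_D * a ^+ D + X * \sum_(i < D) F`_i * a ^+ i * X ^+ (D - i).-1.
  rewrite horner_coef szFD big_ord_recr /= mulrDr addrC; congr (_ + _).
    by rewrite -Xz exprMn; ring.
  rewrite !mulr_sumr; apply: eq_bigr => i _.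
  have -> : X ^+ D = X ^+ i * (X * X ^+ (D - i).-1).
    by rewrite -exprS prednK ?subn_gt0 // -exprD subnKC // ltnW.
  by rewrite -Xz exprMn; ring.
have {XD} : multiples X G (a ^+ D * F`_D).
  have GS : G (\sum_(i < D) F`_i * a ^+ i * X ^+ (D - i).-1).
    by apply: subring_sum => // i _; do ?apply: subringM => //; apply: subringX.
  exists (- \sum_(i < D) F`_i * a ^+ i * X ^+ (D - i).-1); first exact: subringN.
  have : X ^+ D * F.[z] = 0.
    apply: G0; last exact: nulM.
    rewrite XD; apply: subringD => //; apply: subringM => //; exact: subringX.
  by rewrite XD mulrN mulrC => /eqP; rewrite addr_eq0 => /eqP ->; rewrite mulrC.
have aregX k b : G b -> multiples X G (a ^+ k * b) -> multiples X G b.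
  move=> Gb; elim: k => [|k IHk]; first by rewrite mul1r.
  rewrite exprS -mulrA => /areg H; apply: IHk; apply: H.
  by apply: subringM => //; apply: subringX.
move=> /aregX[//|g Gg' gE].
case: D => [|D] in szFD F_neq0 gE *.
  have FE : F = (F`_0)%:P by apply: size1_polyC; rewrite szFD.
  case/eqP: F_neq0; apply: G0 => //.
  by move: nF; rewrite {1}FE hornerC.
(* The leading coefficient being [X g], subtracting this multiple of [X T - a] lowers the degree. *)
pose M := g%:P * 'X^D; have GM : coefs_in G M by apply: coefs_in_monom.
have ME : (X%:P * 'X - a%:P) * M = (X * g)%:P * 'X^(D.+1) - (a * g)%:P * 'X^D.
  by rewrite /M !polyCM exprS; ring.
have GXa : coefs_in G (X%:P * 'X - a%:P).
  apply: coefs_in_subringB => //; last exact: coefs_inC.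
  by rewrite -['X]expr1; apply: coefs_in_monom.
have XaP : (X%:P * 'X - a%:P).[z] = 0 by rewrite !hornerE Xz subrr.
have szF' : (size (F - (X%:P * 'X - a%:P) * M)%R < n)%N.
  apply: leq_trans szF; rewrite szFD ltnS ME gE; apply/leq_sizeP => j ltDj.
  rewrite !coefB !coefCM !coefXn [j == D]gtn_eqF // mulr0 subr0.
  move: ltDj; rewrite leq_eqVlt => /predU1P[<-|ltDj]; first by rewrite eqxx mulr1 subrr.
  by rewrite gtn_eqF // mulr0 subr0 nth_default // szFD.
have [||Q GQ QE] := IHn _ szF'.
- by apply: coefs_in_subringB => //; apply: coefs_in_subringM.
- by rewrite hornerD hornerN hornerM XaP mul0r subr0.
exists (Q + M); first exact: coefs_in_subringD.
by rewrite mulrDr -QE subrK.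
Qed.

(** Since [X T - a = X (T - z)], relations of [z] over [G] have coefficients in [X G[z]]; and
    [X g + a h = X (g + z h)] turns the elements of [G] in [inM] into multiples of [X]. *)
Lemma blowup G a : good G -> local_subring G -> regular_pair G a ->
  exists G', [/\ good G', regular G', G `<=` G',
    forall w, G w -> inM w -> multiples X G' w & tracks G G'].
Proof.
move=> Gg Gloc areg; have [Gring GX G0] := Gg; have [Ga Ma _ agen] := areg.
have [z Xz] := divX Ma.
have G'ring : subring (adjoin G z) by apply: adjoin_subring.
have GM w : G w -> inM w -> multiples X (adjoin G z) w.
  move=> Gw /(agen _ Gw)[g [h [Gg' Gh ->]]]; exists (g + z * h).
    apply: subringD => //; first exact: sub_adjoin.
    by apply: subringM => //; [apply: mem_adjoin | apply: sub_adjoin].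
  by rewrite -Xz mulrDr mulrA.
have [|G'g line] := adjoin_residual_line (z := z) Gg Gloc GM.
  move=> F GF nF; have [Q GQ ->] := blowup_kernel Gg areg Xz GF nF; split.
    move=> i; exists ((if i == 0%N then 0 else Q`_i.-1) - z * Q`_i).
      apply: subringB => //.
        by case: eqP => _; [apply: subring0 | apply: sub_adjoin].
      by apply: subringM => //; [apply: mem_adjoin | apply: sub_adjoin].
    rewrite mulrBl coefB coefCM -mulrA coefCM coefXM -Xz mulrBr mulrA.
    by case: eqP.
  by rewrite hornerM !hornerE Xz subrr mul0r.
exists (adjoin G z); split => //; first exact: line_regular line.
  exact: sub_adjoin.
move=> E Ering Ediv GE; apply: adjoin_sub => //.
by apply: (Ediv X); [apply: GE | | rewrite Xz; apply: GE].
Qed.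

Lemma regular_step G : good G -> regular G ->
  exists G', [/\ good G', regular G', G `<=` G',
    forall w, G w -> inM w -> multiples X G' w & tracks G G'].
Proof.
move=> Gg [Gc|[a Ga]]; first by exists G; split=> //; left.
have [G' [G'g G'r GG' G'M G'E]] :=
  blowup (good_localized Gg) (local_localized Gg) (regular_pair_localized Gg Ga).
have GL := sub_localized Gg.
exists G'; split=> //.
- by move=> w /GL; apply: GG'.
- by move=> w /GL; apply: G'M.
- by move=> E Ering Ediv GE; apply: G'E => //; apply: localized_sub.
Qed.

Lemma good_bigcup (F : set (set W)) : F !=set0 -> (forall G, F G -> good G) ->
  total_on F subset -> good (\bigcup_(G in F) G).
Proof.
move=> [G FG] gF totF; split; last 1 first.
- by move=> w [H FH Hw]; have [_ _] := gF _ FH; apply.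
- have common a b H1 H2 : F H1 -> H1 a -> F H2 -> H2 b -> exists H, [/\ F H, H a & H b].
    move=> F1 Ha F2 Hb; have [sub|sub] := totF _ _ F1 F2.
      by exists H2; split => //; apply: sub.
    by exists H1; split => //; apply: sub.
  split.
  + by exists G => //; case: (gF _ FG) => /subring1.
  + move=> a b [H1 F1 Ha] [H2 F2 Hb]; have [H [FH {}Ha {}Hb]] := common _ _ _ _ F1 Ha F2 Hb.
    by exists H => //; case: (gF _ FH) => Hring _ _; apply: subringB.
  + move=> a b [H1 F1 Ha] [H2 F2 Hb]; have [H [FH {}Ha {}Hb]] := common _ _ _ _ F1 Ha F2 Hb.
    by exists H => //; case: (gF _ FH) => Hring _ _; apply: subringM.
- by exists G => //; case: (gF _ FG).
Qed.

Lemma completion G : good G -> regular G ->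
  exists G', [/\ good G', completed G', local_subring G', G `<=` G' & tracks G G'].
Proof.
move=> Gg Gr; pose next (H H' : set W) := [/\ good H', regular H', H `<=` H',
  forall w, H w -> inM w -> multiples X H' w & tracks H H'].
have /choice[step stepP] : forall H, exists H', good H -> regular H -> next H H'.
  move=> H; have [[Hg Hr]|nH] := pselect (good H /\ regular H).
    by have [H' ?] := regular_step Hg Hr; exists H'.
  by exists H => Hg Hr; case: nH.
pose H n := iter n step G.
have Hgr n : good (H n) /\ regular (H n).
  by elim: n => [//|n [Hg Hr]]; have [] := stepP _ Hg Hr.
have HS n : next (H n) (H n.+1) by case: (Hgr n) => Hg Hr; apply: stepP.
have Hle m n : (m <= n)%N -> H m `<=` H n.
  elim: n => [|n IHn]; first by rewrite leqn0 => /eqP ->.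
  rewrite leq_eqVlt => /predU1P[->//|ltmn] w /(IHn ltmn).
  by have [_ _ + _ _] := HS n; apply.
pose U : set W := \bigcup_(K in range H) K.
have HU n : H n `<=` U by move=> w Hw; exists (H n) => //; exists n.
have Ug : good U.
  apply: good_bigcup; first by exists (H 0%N), 0%N.
    by move=> _ [n _ <-]; case: (Hgr n).
  move=> _ _ [m _ <-] [n _ <-]; case: (leqP m n) => [lemn|/ltnW lenm].
    by left; apply: Hle.
  by right; apply: Hle.
have Uc : completed U.
  move=> w [_ [n _ <-] Hw] Mw; have [_ _ _ + _] := HS n.
  by move=> /(_ _ Hw Mw)[g Hg <-]; exists g => //; apply: HU Hg.
(* Nothing in [next] makes the stages local, hence this last localization. *)
exists (localized U); split.
- exact: good_localized.
- exact: completed_localized.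
- exact: local_localized.
- by move=> g Gg'; apply: sub_localized => //; apply: (HU 0%N).
move=> E Ering Ediv GE; apply: localized_sub => // w [_ [n _ <-]].
by elim: n w => // n IHn; have [_ _ _ _] := HS n; apply.
Qed.

(** [G[y]] has special fibre [k[y]] but need not be completed, as the image of [y] in the residue
    field of [R] may be algebraic over [k]. Hence a new round of blowing up. *)
Lemma free_extension G y : good G -> completed G -> local_subring G ->
  (forall F, coefs_in G F -> nul F.[y] -> F = 0) ->
  exists G', [/\ good G', completed G', local_subring G', adjoin G y `<=` G' &
    tracks (adjoin G y) G'].
Proof.
move=> Gg Gc Gl yfree; have [Gring GX _] := Gg.
have [||G'g line] := adjoin_residual_line (z := y) Gg Gl.
- by move=> w Gw Mw; have [g Gg' <-] := Gc _ Gw Mw; exists g => //; apply: sub_adjoin.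
- move=> F GF /(yfree _ GF) ->; split; last by rewrite horner0.
  by move=> i; rewrite coef0; apply: multiples0; apply: adjoin_subring.
exact: completion (line_regular G'g line).
Qed.

(* Zorn's lemma applies to the completed subrings contained in [E i] for every [i]
   which they do not hit: [Y i] is then still free to be adjoined. *)
Lemma exists_complete_cover (I : Type) (Y : I -> W) (E : I -> set W)
    (hits : I -> set W) G0 :
  (forall i, subring (E i)) -> (forall i, division_closed (E i)) ->
  (forall i j, j <> i -> E i (Y j)) ->
  (forall i F, coefs_in (E i) F -> nul F.[Y i] -> coefs_in nul F) ->
  (forall i, hits i (Y i)) ->
  good G0 -> regular G0 -> (forall i, G0 `<=` E i) ->
  exists G, [/\ good G, completed G, local_subring G &
    forall i, exists2 w, G w & hits i w].
Proof.
move=> Ering Ediv EY Yfree hY G0g G0r G0E.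
pose fresh G := forall i, (forall w, G w -> ~ hits i w) -> G `<=` E i.
pose P G := [/\ good G, completed G, local_subring G & fresh G].
pose P0 G := G = set0 \/ P G.
have [|G [P0G Gmax]] := @Zorn_bigcup W P0.
  move=> F FP totF; have [allF0|] := pselect (forall G, F G -> G = set0).
    by left; apply/seteqP; split => // w [G /allF0 ->].
  move=> /existsNP[K /not_implyP[FK K0]]; right.
  pose F' := [set G | F G /\ P G].
  have -> : \bigcup_(G in F) G = \bigcup_(G in F') G.
    apply/seteqP; split => [w [G FG Gw]|w [G [FG _] Gw]]; last by exists G.
    exists G => //; split => //; case: (FP _ FG) => // G0'.
    by move: Gw; rewrite G0'.
  have F'K : F' K by split => //; case: (FP _ FK).
  split.
  - apply: good_bigcup; [by exists K | by move=> G [_ []] |].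
    by move=> G H [FG _] [FH _]; apply: totF.
  - move=> w [G F'G Gw] Mw; have [_ [_ Gc _ _]] := F'G.
    by have [g Gg <-] := Gc _ Gw Mw; exists g => //; exists G.
  - move=> w [G F'G Gw] Mw; have [_ [_ _ Gl _]] := F'G.
    by have [v Gv wv1] := Gl _ Gw Mw; exists v => //; exists G.
  - move=> i nhits w [G F'G Gw]; have [_ [_ _ _ Gf]] := F'G.
    by apply: (Gf i) => // v Gv; apply: nhits; exists G.
have {P0G} PG : P G.
  case: P0G => // G0'.
  have [G1 [G1g G1c G1l G01 G1t]] := completion G0g G0r.
  case: (Gmax G1).
    rewrite G0'; split => // /(_ 1); apply.
    by case: G1g => /subring1.
  by right; split => // i _; apply: G1t.
exists G; case: (PG) => Gg Gc Gl Gf; split => // i; apply: contrapT => nhits.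
have {}nhits w : G w -> ~ hits i w by move=> Gw hw; apply: nhits; exists w.
have GE := Gf _ nhits.
have [G' [G'g G'c G'l G'y G't]] : exists G', [/\ good G', completed G',
    local_subring G', adjoin G (Y i) `<=` G' & tracks (adjoin G (Y i)) G'].
  apply: free_extension => // F GF nF; apply/polyP => j; rewrite coef0.
  have [_ _ G0'] := Gg; apply: G0' => //.
  by apply: (Yfree i) nF j => k; apply: GE.
have GG' : G `<=` G' by move=> w Gw; apply: G'y; apply: sub_adjoin => //; case: Gg.
have G'Y : G' (Y i) by apply: G'y; apply: mem_adjoin; case: Gg.
case: (Gmax G').
  by split => // /(_ _ G'Y) /nhits; apply; apply: hY.
(* [G'] hits [i], so an index [j] that it misses differs from [i], and [Y i] belongs to [E j]. *)
right; split => // j nhits'.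
apply: G't => //; apply: adjoin_sub => //.
  by apply: Gf => w /GG'; apply: nhits'.
by apply: EY => ij; apply: (nhits' (Y i)) => //; rewrite ij; apply: hY.
Qed.

Lemma int_adjoin_regular (G := adjoin (range (fun k : int => k%:~R : W)) X) :
  (forall k : int, nul k%:~R -> k = 0) ->
  (forall F, coefs_in (range (fun k : int => k%:~R)) F -> nul F.[X] -> coefs_in nul F) ->
  good G /\ regular G.
Proof.
move=> nul_int Xfree; set Z := range _ in Xfree G *.
have Zring : subring Z.
  split; first by exists 1.
  - by move=> _ _ [k _ <-] [l _ <-]; exists (k - l) => //; rewrite rmorphB.
  - by move=> _ _ [k _ <-] [l _ <-]; exists (k * l) => //; rewrite rmorphM.
have Z0 a : Z a -> nul a -> a = 0 by move=> [k _ <-] /nul_int ->.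
have Xfree0 F : coefs_in Z F -> nul F.[X] -> F = 0.
  by move=> ZF /(Xfree _ ZF) nF; apply/polyP => i; rewrite coef0; apply: Z0.
have Gg : good G.
  split; [exact: adjoin_subring | exact: mem_adjoin |].
  by move=> _ [F ZF <-] /(Xfree0 _ ZF) ->; rewrite horner0.
split=> //; have [Gring GX G0] := Gg.
have ZG : Z `<=` G by apply: sub_adjoin.
have Gsplit w : G w -> exists (k : int) g, G g /\ w = k%:~R + X * g.
  move=> [F ZF <-]; have [k _ kE] := ZF 0%N.
  pose F' := \poly_(i < (size F).-1) F`_i.+1.
  exists k, F'.[X]; split.
    exists F' => // i; rewrite coef_poly.
    by case: ifP => _; [apply: ZF | apply: subring0].
  have -> : F = k%:~R%:P + 'X * F'; last by rewrite hornerD hornerC hornerM hornerX.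
  apply/polyP => i; rewrite coefD coefC coefXM coef_poly kE.
  case: i => [|i] /=; first by rewrite addr0.
  rewrite add0r; case: ltnP => // lei; rewrite nth_default //.
  by move: lei; case: (size F).
have MX g : inM (X * g) by rewrite mulrC; apply: inMM.
have [[p0]|nop] := pselect (exists p : nat, (0 < p)%N /\ inM p%:R); last first.
  left => w Gw Mw; have [k [g [Gg' wE]]] := Gsplit _ Gw.
  have Mk : inM k%:~R by rewrite -[k%:~R](addrK (X * g)) -wE; apply: inMB.
  have [k0|k_neq0] := eqVneq k 0; first by exists g => //; rewrite wE k0 add0r.
  case: nop; exists `|k|%N; rewrite absz_gt0; split => //.
  by rewrite pmulrn abszEsign rmorphM; apply: inMM.
(* The least positive integer in [inM] is the residue characteristic, the second element of the
   regular pair. *)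
move=> p0P; pose Q n := (0 < n)%N && `[< inM n%:R >].
have [|p /andP[p_gt0 /asboolP Mp] pmin] := @ex_minnP Q.
  by exists p0; rewrite /Q; case: p0P => -> ?; apply/asboolP.
have pdvd (k : int) : inM k%:~R -> exists l : int, k = p%:Z * l.
  move=> Mk; exists (k %/ p)%Z; rewrite mulrC.
  suff /eqP r0 : (k %% p)%Z == 0 by rewrite {1}(divz_eq k p) r0 addr0.
  have p_neq0 : p%:Z != 0 by rewrite eqz_nat -lt0n.
  have r_ge0 := modz_ge0 k p_neq0; have r_ltp := ltz_pmod k (p_gt0 : 0 < p%:Z).
  apply: contrapT => /negP r_neq0.
  have : (p <= `|(k %% p)%Z|)%N.
    apply: pmin; rewrite /Q absz_gt0 r_neq0; apply/asboolP.
    rewrite pmulrn gez0_abs // /modz rmorphB rmorphM /=.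
    by apply: inMB => //; apply: inMM.
  by rewrite leqNgt -ltz_nat gez0_abs // r_ltp.
right; exists p%:R; split => //.
- by rewrite -[p%:R]/(p%:Z%:~R); apply: ZG; exists p.
(* A relation [p b = X h] has constant coefficient [p k], with [k] that of [b]; as [X] is
   transcendental over the integers, [k] is zero. *)
- move=> b Gb [h Gh hE]; have [k [g [Gg' bE]]] := Gsplit _ Gb.
  suff k0 : k = 0 by exists g => //; rewrite bE k0 add0r.
  have : G (h - p%:R * g) by apply: subringB => //; apply: subringM => //; rewrite -[p%:R]/(p%:Z%:~R); apply: ZG; exists p.
  move=> [F ZF FE].
  have : ((p%:Z * k)%:~R%:P - 'X * F).[X] = 0.
    rewrite !hornerE FE mulrBr hE bE rmorphM /= -[p%:~R]/(p%:R); ring.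
  move=> E0; have : (p%:Z * k)%:~R%:P - 'X * F = 0.
    apply: Xfree0; last by rewrite E0.
    apply: coefs_in_subringB => //; first by apply: coefs_inC => //; exists (p%:Z * k).
    by apply: coefs_in_subringM => //; rewrite -['X]expr1; apply: coefs_inXn.
  move=> /(congr1 (fun H : {poly W} => H`_0)).
  rewrite coefB coefC coefXM subr0 coef0 /= => pk0.
  have /eqP : p%:Z * k = 0 by apply: nul_int; rewrite pk0.
  by rewrite mulf_eq0 eqz_nat eqn0Ngt p_gt0 => /eqP.
- move=> w Gw Mw; have [k [g [Gg' wE]]] := Gsplit _ Gw.
  have [|l kE] := pdvd k; first by rewrite -[k%:~R](addrK (X * g)) -wE; apply: inMB.
  exists g, l%:~R; split => //; first by apply: ZG; exists l.
  by rewrite wE kE rmorphM addrC.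
Qed.

End Blowup.

(** * A field with many independent transcendental elements *)

Section IntegralType.
Variables (D : comNzRingType) (Dint : forall a b : D, a * b = 0 -> a = 0 \/ b = 0).

Definition integral_type of phant D : Type := D.
Local Notation D' := (integral_type (Phant D)).

HB.instance Definition _ := GRing.ComNzRing.on D'.

Definition integral_unit : pred D' := fun a => `[< exists b : D, b * a = 1 >].

Definition integral_inv (a : D') : D' :=
  if pselect (exists b : D, b * a = 1) is left h then projT1 (cid h) else a.

Let mulVx : {in integral_unit, left_inverse (1 : D') integral_inv *%R}.
Proof.
move=> a /asboolP ua; rewrite /integral_inv; case: pselect => // h.
by case: (cid h).
Qed.

Let unitPl (a b : D') : b * a = 1 -> integral_unit a.
Proof. by move=> ba1; apply/asboolP; exists b. Qed.

Let inv_out : {in [predC integral_unit], integral_inv =1 id}.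
Proof.
by move=> a /asboolPn nu; rewrite /integral_inv; case: pselect.
Qed.

HB.instance Definition _ := GRing.ComNzRing_hasMulInverse.Build D' mulVx unitPl inv_out.

Let integralP : GRing.integral_domain_axiom D'.
Proof. by move=> a b /Dint[] ->; rewrite eqxx ?orbT. Qed.

HB.instance Definition _ := GRing.ComUnitRing_isIntegral.Build D' integralP.

Definition integral_domain : idomainType := D'.

End IntegralType.

Section LinePolynomials.
Variable I : Type.

(* A substitute for the polynomial ring in the variables [I]: restricting to the
   line through two points makes it an integral domain. *)
Definition line_polynomial : {pred (I -> rat) -> rat} := fun f =>
  `[< forall u v : I -> rat, exists p : {poly rat},
      forall t, f (fun i => u i + t * v i) = p.[t] >].

Lemma line_polynomialP f : reflect (forall u v, exists p : {poly rat},
   forall t, f (fun i => u i + t * v i) = p.[t]) (f \in line_polynomial).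
Proof. exact: asboolP. Qed.

Lemma line_polynomial_closed : subring_closed line_polynomial.
Proof.
split.
- by apply/line_polynomialP => u v; exists 1%:P => t; rewrite hornerC.
- move=> f g /line_polynomialP fP /line_polynomialP gP; apply/line_polynomialP => u v.
  have [[p pE] [q qE]] := (fP u v, gP u v); exists (p - q) => t.
  by rewrite hornerD hornerN -pE -qE.
- move=> f g /line_polynomialP fP /line_polynomialP gP; apply/line_polynomialP => u v.
  have [[p pE] [q qE]] := (fP u v, gP u v); exists (p * q) => t.
  by rewrite hornerM -pE -qE.
Qed.

HB.instance Definition _ :=
  GRing.isSubringClosed.Build _ line_polynomial line_polynomial_closed.

Record linepoly := LinePoly { linepoly_fun  :> (I -> rat) -> rat;
  linepolyP : linepoly_fun \in line_polynomial }.

HB.instance Definition _ := [isSub for linepoly_fun].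
HB.instance Definition _ := [Choice of linepoly by <:].
HB.instance Definition _ :=
  GRing.SubChoice_isSubComPzRing.Build _ _ linepoly (subringClosedP _).

Let linepoly_neq0 : (1 : linepoly) != 0.
Proof.
apply/eqP => /(congr1 (fun f : linepoly => f (fun=> 0))).
by apply/eqP; rewrite oner_eq0.
Qed.

HB.instance Definition _ := GRing.PzSemiRing_isNonZero.Build linepoly linepoly_neq0.
HB.instance Definition _ := GRing.ComPzRing.on linepoly.

Definition evaluate (u : I -> rat) (f : linepoly) : rat := f u.

Let evaluate_is_zmod_morphism u : zmod_morphism (evaluate u).
Proof. by []. Qed.

Let evaluate_is_monoid_morphism u : monoid_morphism (evaluate u).
Proof. by []. Qed.

HB.instance Definition _ u :=
  GRing.isZmodMorphism.Build linepoly rat (evaluate u) (evaluate_is_zmod_morphism u).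
HB.instance Definition _ u :=
  GRing.isMonoidMorphism.Build linepoly rat (evaluate u) (evaluate_is_monoid_morphism u).

Lemma evaluate_inj (f g : linepoly) : (forall u, evaluate u f = evaluate u g) -> f = g.
Proof. by move=> fg; apply: val_inj; apply/funext. Qed.

Lemma poly_rat_eq0 (p : {poly rat}) : (forall t, p.[t] = 0) -> p = 0.
Proof.
move=> p0; apply/eqP; apply: contraT => p_neq0.
pose s : seq rat := [seq n%:R | n <- iota 0 (size p)].
have /(max_poly_roots p_neq0) : all (root p) s by apply/allP => t _; apply/rootP.
rewrite size_map size_iota ltnn; apply.
rewrite map_inj_in_uniq ?iota_uniq // => m n _ _ /eqP.
by rewrite Num.Theory.eqr_nat => /eqP.
Qed.

(** If [f u] is nonzero, join [u] to any [v] by a line. The restrictions satisfy [p q = 0] and [p]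
    does not vanish at parameter 0, so [q = 0]; its value at parameter 1 is [g v]. *)
Lemma linepoly_integral (f g : linepoly) : f * g = 0 -> f = 0 \/ g = 0.
Proof.
move=> fg0; have [|nf] := pselect (forall u, evaluate u f = 0).
  by move=> f0; left; apply: evaluate_inj => u; rewrite f0.
right; apply: evaluate_inj => v; rewrite rmorph0.
have [u /eqP fu] : exists u, evaluate u f <> 0 by apply/existsNP.
have /line_polynomialP/(_ u (fun i => v i - u i))[p pE] := linepolyP f.
have /line_polynomialP/(_ u (fun i => v i - u i))[q qE] := linepolyP g.
have pq0 : p * q = 0.
  apply: poly_rat_eq0 => t; rewrite hornerM -pE -qE.
  set w := (fun i => _ : rat).
  by rewrite -[LHS]/(evaluate w (f * g)) fg0.
move/eqP: pq0; rewrite mulf_eq0 => /orP[]/eqP p0.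
  case/eqP: fu; have := pE 0; rewrite p0 horner0 => <-; rewrite /evaluate; congr (linepoly_fun f _).
  by apply/funext => i; rewrite mul0r addr0.
have := qE 1; rewrite p0 horner0 => <-; rewrite /evaluate; congr (linepoly_fun g _).
by apply/funext => i; rewrite mul1r addrC subrK.
Qed.

Definition coordinate_fun (i : I) (u : I -> rat) : rat := u i.

Lemma coordinate_line_polynomial i : coordinate_fun i \in line_polynomial.
Proof.
apply/line_polynomialP => u v; exists ((u i)%:P + 'X * (v i)%:P) => t.
by rewrite hornerD hornerM hornerX !hornerC.
Qed.

Definition coordinate i : linepoly := LinePoly (coordinate_line_polynomial i).

Definition independent_of (i : I) : set linepoly :=
  [set f | forall u v, (forall j, j <> i -> u j = v j) -> evaluate u f = evaluate v f].

Lemma independent_of_subring i : subring (independent_of i).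
Proof.
split=> [u v _|f g fi gi u v uv|f g fi gi u v uv]; first by rewrite !rmorph1.
  by rewrite !rmorphB /= (fi u v) // (gi u v).
by rewrite !rmorphM /= (fi u v) // (gi u v).
Qed.

(** Moving only the coordinate [i] of a point leaves the values of the coefficients unchanged, so
    the evaluated polynomial has every rational as a root. *)
Lemma coordinate_transcendental i (P : {poly linepoly}) :
  coefs_in (independent_of i) P -> P.[coordinate i] = 0 -> P = 0.
Proof.
move=> Pi P0; apply/polyP => k; rewrite coef0; apply: evaluate_inj => u.
rewrite rmorph0 -(coef_map (evaluate u)) /=.
suff -> : map_poly (evaluate u) P = 0 by rewrite coef0.
apply: poly_rat_eq0 => t; pose v j := if pselect (j = i) then t else u j.
have -> : map_poly (evaluate u) P = map_poly (evaluate v) P.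
  apply/polyP => l; rewrite !coef_map /=; apply: Pi => j ji.
  by rewrite /v; case: pselect.
have -> : t = evaluate v (coordinate i).
  by rewrite /evaluate /= /coordinate_fun /v; case: pselect.
by rewrite horner_map P0 rmorph0.
Qed.

Definition linepoly_field : fieldType := {fraction integral_domain linepoly_integral}.

Definition linepoly_frac (f : linepoly) : linepoly_field :=
  FracField.tofrac (f : integral_domain linepoly_integral).

Let frac_is_zmod_morphism : zmod_morphism linepoly_frac.
Proof. by move=> f g; apply: (@tofracB (integral_domain linepoly_integral) f g). Qed.

Let frac_is_monoid_morphism : monoid_morphism linepoly_frac.
Proof.
split; first exact: (@tofrac1 (integral_domain linepoly_integral)).
by move=> f g; apply: (@tofracM (integral_domain linepoly_integral) f g).
Qed.

HB.instance Definition _ := GRing.isZmodMorphism.Build linepoly linepoly_field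
  linepoly_frac frac_is_zmod_morphism.
HB.instance Definition _ := GRing.isMonoidMorphism.Build linepoly linepoly_field
  linepoly_frac frac_is_monoid_morphism.

Lemma linepoly_frac_eq0 f : linepoly_frac f = 0 -> f = 0.
Proof. by move/eqP; rewrite tofrac_eq0 => /eqP. Qed.

End LinePolynomials.

Lemma polyCM2_addX (K : comNzRingType) (a b c : K) (F : {poly K}) :
  a%:P * b%:P * (F * 'X + c%:P) = b%:P * (a%:P * F) * 'X + (c * b * a)%:P.
Proof. by rewrite !polyCM; ring. Qed.

(** [L] is the fraction field of the line polynomials, and [E i] the subfield of fractions free of
    the variable [i]. *)
Lemma exists_fresh_variables (I : Type) :
  exists (L : fieldType) (Y : I -> L) (E : I -> set L),
  [/\ forall i, subring (E i),
      forall i s w, E i s -> s <> 0 -> E i (s * w) -> E i w,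
      forall i j, j <> i -> E i (Y j),
      forall i F, coefs_in (E i) F -> F.[Y i] = 0 -> F = 0 &
      forall k : int, k%:~R = 0 :> L -> k = 0].
Proof.
pose frac := @linepoly_frac I; have frac_eq0 := @linepoly_frac_eq0 I.
pose E i : set (linepoly_field I) := [set w | exists f g : linepoly I,
  [/\ independent_of i f, independent_of i g, g <> 0 & w * frac g = frac f]].
have lpM_neq0 (f g : linepoly I) : f <> 0 -> g <> 0 -> f * g <> 0.
  by move=> f0 g0 /linepoly_integral[].
have iring := @independent_of_subring I.
exists (linepoly_field I), (fun i => frac (coordinate i)), E; split.
- move=> i; split.
  + exists 1, 1; split; [exact: subring1 | exact: subring1 | by apply/eqP/oner_neq0 |].
    by rewrite mul1r.
  + move=> a b [f [g [fi gi g0 aE]]] [f' [g' [f'i g'i g'0 bE]]].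
    exists (f * g' - f' * g), (g * g'); split.
    * by apply: (subringB (iring i)); apply: (subringM (iring i)).
    * exact: (subringM (iring i)).
    * exact: lpM_neq0.
    * by rewrite /frac rmorphB !rmorphM /= -[linepoly_frac f]aE -[linepoly_frac f']bE; ring.
  + move=> a b [f [g [fi gi g0 aE]]] [f' [g' [f'i g'i g'0 bE]]].
    exists (f * f'), (g * g'); split.
    * exact: (subringM (iring i)).
    * exact: (subringM (iring i)).
    * exact: lpM_neq0.
    * by rewrite /frac !rmorphM /= -[linepoly_frac f]aE -[linepoly_frac f']bE; ring.
- move=> i s w [f [g [fi gi g0 sE]]] s0 [f' [g' [f'i g'i g'0 swE]]].
  exists (f' * g), (f * g'); split.
  + exact: (subringM (iring i)).
  + exact: (subringM (iring i)).
  + apply: lpM_neq0 => // f0; move/eqP: sE; rewrite f0 /frac rmorph0 mulf_eq0.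
    by move=> /orP[/eqP //|/eqP/frac_eq0].
  + by rewrite /frac !rmorphM /= -[linepoly_frac f']swE -[linepoly_frac f]sE; ring.
- move=> i j ji; exists (coordinate j), 1; split.
  + by move=> u v uv; apply: uv.
  + exact: subring1.
  + by apply/eqP/oner_neq0.
  + by rewrite /frac rmorph1 mulr1.
- move=> i F EF F0.
  (* A common denominator [g], itself free of the variable [i], brings the coefficients of [F] back
     to line polynomials. *)
  have [g [P [g0 gi Pi PE]]] : exists (g : linepoly I) (P : {poly linepoly I}),
      [/\ g <> 0, independent_of i g, coefs_in (independent_of i) P &
          (frac g)%:P * F = map_poly frac P].
    elim/poly_ind: F EF {F0} => [_|F c IHF EFc].
      exists 1, 0; split; [by apply/eqP/oner_neq0 | exact: subring1 | | by rewrite mulr0 map_poly0].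
      by move=> k; rewrite coef0; apply: (subring0 (iring i)).
    have [|g [P [g0 gi Pi PE]]] := IHF.
      by move=> k; have := EFc k.+1; rewrite coefD coefMX coefC /= addr0.
    have [f' [g' [f'i g'i g'0 cE]]] : E i c.
      by have := EFc 0%N; rewrite coefD coefMX coefC /= add0r.
    exists (g * g'), (g'%:P * P * 'X + (f' * g)%:P); split.
    + exact: lpM_neq0.
    + exact: (subringM (iring i)).
    + apply: (coefs_in_subringD (iring i)); last first.
        by apply: (coefs_inC (iring i)); apply: (subringM (iring i)).
      apply: (coefs_in_subringM (iring i)); last first.
        by rewrite -['X]expr1; apply: (coefs_inXn (iring i)).
      by apply: (coefs_in_subringM (iring i)) => //; apply: (coefs_inC (iring i)).
    + rewrite /frac in PE *; rewrite rmorphD /= map_polyC !rmorphM /= map_polyC map_polyX -PE rmorphM /= -[linepoly_frac f']cE.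
      exact: polyCM2_addX.
  have P0 : P = 0.
    apply: (coordinate_transcendental Pi); apply: frac_eq0.
    by rewrite -horner_map -PE hornerM F0 mulr0.
  have /eqP : (frac g)%:P * F = 0 by rewrite PE P0 map_poly0.
  by rewrite mulf_eq0 polyC_eq0 => /orP[/eqP/frac_eq0 //|/eqP].
- move=> k k0; have : linepoly_frac (k%:~R : linepoly I) = 0 by rewrite rmorph_int.
  move=> /frac_eq0/(congr1 (evaluate (fun=> 0))); rewrite rmorph_int rmorph0.
  by move=> /eqP; rewrite intr_eq0 => /eqP.
Qed.

(** * Artinian local principal ideal rings are quotients of discrete valuation rings *)

Lemma submoduleP (R : comNzRingType) (M : lmodType R) (N : set M) :
  submodule N <-> N 0 /\ forall a u v, N u -> N v -> N (a *: u + v).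
Proof.
split=> [[N0 NL]|[N0 NL]]; split.
- by move: N0; rewrite inE.
- by move=> a u v Nu Nv; have := NL a u v; rewrite !inE; apply.
- by rewrite inE.
- by move=> a u v; rewrite !inE; apply: NL.
Qed.

Lemma idealP (R : comNzRingType) (I : set R) :
  ideal I <-> I 0 /\ forall a u v, I u -> I v -> I (a * u + v).
Proof. exact: (@submoduleP R R^o). Qed.

Lemma span_submodule (R : comNzRingType) (M : lmodType R) (A : set M) :
  submodule (span A).
Proof.
apply/submoduleP; split=> [N [/submoduleP[]]//|a u v Nu Nv N [Nsub AN]].
by have /submoduleP[_] := Nsub; apply; [apply: Nu | apply: Nv].
Qed.

Lemma ideal_gen1 (R : comNzRingType) (a : R) : ideal_gen [set a] = range ( *%R a).
Proof.
apply/seteqP; split.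
  apply: smallest_sub; last by move=> _ ->; exists 1; rewrite ?mulr1.
  apply/idealP; split; first by exists 0; rewrite ?mulr0.
  by move=> b _ _ [c _ <-] [d _ <-]; exists (b * c + d) => //=; ring.
move=> _ [c _ <-]; have /idealP[I0 IL] : ideal (ideal_gen [set a]) by apply: span_submodule.
by rewrite mulrC -[_ * _]addr0; apply: IL => //; apply: sub_gen_smallest.
Qed.

Section SubringType.
Variables (W : comNzRingType) (G : set W) (Gring : subring G).

Definition subring_pred of subring G : {pred W} := fun w => `[< G w >].

Let subring_pred_closed : subring_closed (subring_pred Gring).
Proof.
split; first by apply/asboolP; apply: subring1.
  by move=> a b /asboolP Ga /asboolP Gb; apply/asboolP; apply: subringB.
by move=> a b /asboolP Ga /asboolP Gb; apply/asboolP; apply: subringM.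
Qed.

HB.instance Definition _ :=
  GRing.isSubringClosed.Build W (subring_pred Gring) subring_pred_closed.

Record subring_type := SubringType {
  subring_val :> W; subring_valP : subring_val \in subring_pred Gring }.

HB.instance Definition _ := [isSub for subring_val].
HB.instance Definition _ := [Choice of subring_type by <:].
HB.instance Definition _ := [SubChoice_isSubComNzRing of subring_type by <:].

Lemma range_subring_val : range subring_val = G.
Proof.
apply/seteqP; split=> [_ [w _ <-]|w Gw]; first exact/asboolP/subring_valP.
have Gw' : w \in subring_pred Gring by apply/asboolP.
by exists (SubringType Gw').
Qed.

End SubringType.

Section PrimeQuotient.
Variables (D : comNzRingType) (I : set D) (Iprime : prime_ideal I).

Definition ideal_pred of prime_ideal I : {pred D} := fun a => `[< I a >].

Let ideal_pred_closed : idealr_closed (ideal_pred Iprime).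
Proof.
have [I0 I1 IB IM _] := Iprime; split.
- exact/asboolP.
- exact/asboolPn.
move=> a u v /asboolP Iu /asboolP Iv; apply/asboolP.
by rewrite -[v]opprK -[- v]sub0r; apply: (IB); [apply: IM | apply: IB].
Qed.

HB.instance Definition _ := isIdealr.Build D (ideal_pred Iprime) ideal_pred_closed.

Definition prime_quotient := {ideal_quot (ideal_pred Iprime)}.

HB.instance Definition _ := GRing.ComNzRing.on prime_quotient.

Definition prime_proj (d : D) : prime_quotient := (\pi d)%qT.

Lemma prime_proj_eq0 d : prime_proj d = 0 <-> I d.
Proof.
have -> : (0 : prime_quotient) = prime_proj 0 by rewrite /prime_proj rmorph0.
split=> [/eqP|Id]; last apply/eqP; rewrite /prime_proj -Quotient.idealrBE subr0; last exact/asboolP.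
by move/asboolP.
Qed.

Lemma prime_proj_surj s : exists d, prime_proj d = s.
Proof. by exists (repr s); rewrite /prime_proj reprK. Qed.

Lemma prime_quotient_integral (s t : prime_quotient) : s * t = 0 -> s = 0 \/ t = 0.
Proof.
have [[a <-] [b <-]] := (prime_proj_surj s, prime_proj_surj t).
have <- : prime_proj (a * b) = prime_proj a * prime_proj b by apply: rmorphM.
move=> /prime_proj_eq0 Iab.
have [_ _ _ _ Iprod] := Iprime.
by case: (Iprod _ _ Iab) => /prime_proj_eq0 ->; [left | right].
Qed.

Definition prime_domain : idomainType := integral_domain prime_quotient_integral.

Definition prime_domain_proj (d : D) : prime_domain := prime_proj d.

Let proj_is_zmod_morphism : zmod_morphism prime_domain_proj.
Proof. by move=> a b; apply: (rmorphB (\pi_prime_quotient)%qT). Qed.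

Let proj_is_monoid_morphism : monoid_morphism prime_domain_proj.
Proof.
split; first exact: (rmorph1 (\pi_prime_quotient)%qT).
by move=> a b; apply: (rmorphM (\pi_prime_quotient)%qT).
Qed.

HB.instance Definition _ := GRing.isZmodMorphism.Build D prime_domain
  prime_domain_proj proj_is_zmod_morphism.
HB.instance Definition _ := GRing.isMonoidMorphism.Build D prime_domain
  prime_domain_proj proj_is_monoid_morphism.

End PrimeQuotient.

Lemma rmorphism_factor (D S R : comNzRingType) (p : {rmorphism D -> S})
    (f : {rmorphism D -> R}) :
  (forall s, exists d, p d = s) -> (forall d, p d = 0 -> f d = 0) ->
  exists g : {rmorphism S -> R}, forall d, g (p d) = f d.
Proof.
move=> /choice[sec secK] kerpf; pose g s := f (sec s).
have fE a b : p a = p b -> f a = f b.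
  move=> pab; apply/eqP; rewrite -subr_eq0 -rmorphB; apply/eqP/kerpf.
  by rewrite rmorphB pab subrr.
have gz : zmod_morphism g.
  by move=> a b; rewrite -rmorphB; apply: fE; rewrite rmorphB !secK.
have gm : monoid_morphism g.
  split; first by rewrite -(rmorph1 f); apply: fE; rewrite rmorph1 secK.
  by move=> a b; rewrite -rmorphM; apply: fE; rewrite rmorphM !secK.
pose h : {rmorphism S -> R} := HB.pack g (GRing.isZmodMorphism.Build S R g gz)
  (GRing.isMonoidMorphism.Build S R g gm).
by exists h; move=> d; apply: fE; rewrite secK.
Qed.

(* A local ring [D] with principal maximal ideal [X G] becomes a discrete
   valuation ring after division by the prime ideal of elements divisible by
   every power of [X]. *)
Lemma dvr_quotient (D R : comNzRingType) (X : D) (f : {rmorphism D -> R}) (n : nat) :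
  (forall b, X * b = 0 -> b = 0) -> (forall b, X * b <> 1) ->
  (forall d, (exists b, d = X * b) \/ (exists b, d * b = 1)) ->
  (forall r, exists d, f d = r) -> f X ^+ n = 0 -> (forall i, f X ^+ i = 0 -> (n <= i)%N) ->
  artinian_hypersurface R.
Proof.
move=> Xreg Xnu Dloc fsurj fXn nmin.
have XnK i b : X ^+ i * b = 0 -> b = 0.
  by elim: i => [|i IHi]; rewrite ?mul1r // exprS -mulrA => /Xreg.
pose I : set D := [set d | forall i, exists b, d = X ^+ i * b].
(* A largest power of [X] divides [d]; the cofactor is not a multiple of [X], hence a unit. *)
have notI d : ~ I d -> exists i u v, d = X ^+ i * u /\ u * v = 1.
  move=> /existsNP[i nd]; have : exists k, `[< ~ exists b, d = X ^+ k * b >] by exists i; apply/asboolP.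
  move=> /ex_minnP[[|k] /asboolP dk kmin]; first by case: dk; exists d; rewrite mul1r.
  have [[b dE]|nb] := pselect (exists b, d = X ^+ k * b); last first.
    have /kmin : `[< ~ exists b, d = X ^+ k * b >] by apply/asboolP.
    by rewrite ltnn.
  exists k, b; have [[c bE]|[v bv]] := Dloc b; last by exists v.
  by case: dk; exists c; rewrite exprSr -mulrA -bE.
have unitNI i u v : u * v = 1 -> ~ I (X ^+ i * u).
  move=> uv1 /(_ i.+1)[b E]; apply: (Xnu (b * v)).
  apply/eqP; rewrite -subr_eq0 mulrA -uv1 -mulrBl; apply/eqP.
  by rewrite (XnK i (X * b - u)) ?mul0r // mulrBr E exprSr mulrA subrr.
have Iprime : prime_ideal I.
  split.
  - by move=> i; exists 0; rewrite mulr0.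
  - by move=> I1; apply: (unitNI 0%N 1 1); rewrite ?mulr1 ?mul1r.
  - by move=> a b Ia Ib i; have [[c ->] [d ->]] := (Ia i, Ib i); exists (c - d); rewrite mulrBr.
  - by move=> a b Ib i; have [d ->] := Ib i; exists (a * d); rewrite mulrCA.
  - move=> a b Iab; apply: contrapT => /not_orP[/notI[i [u [u' [aE uu']]]] /notI[j [v [v' [bE vv']]]]].
    apply: (unitNI (i + j)%N (u * v) (u' * v')); first by rewrite mulrACA uu' vv' mulr1.
    by rewrite exprD -mulrACA -aE -bE.
pose S := prime_domain Iprime; pose p : {rmorphism D -> S} := prime_domain_proj Iprime.
have p0 d : p d = 0 <-> I d by apply: prime_proj_eq0.
have psurj s : exists d, p d = s by apply: prime_proj_surj.
(* Nilpotency of the image of [X] lets [f] factor through the quotient by [I]. *)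
have fI d : I d -> f d = 0 by move=> /(_ n)[b ->]; rewrite rmorphM rmorphXn fXn mul0r.
have [phi phiE] : exists phi : {rmorphism S -> R}, forall d, phi (p d) = f d.
  by apply: rmorphism_factor => // d /p0; apply: fI.
have Snz s : s != 0 -> exists i (u v : S), s = p X ^+ i * u /\ u * v = 1.
  have [d <-] := psurj s; move=> /eqP pd.
  have [|i [u [v [dE uv]]]] := notI d; first by move/p0.
  exists i, (p u), (p v); split; first by rewrite dE rmorphM rmorphXn.
  by rewrite -rmorphM uv rmorph1.
have pX_neq0 : p X <> 0.
  by move=> /p0; rewrite -[X]expr1 -[X ^+ 1]mulr1; apply: (unitNI 1%N 1 1); rewrite mulr1.
have pX_nu (s : S) : p X * s <> 1.
  have [d <-] := psurj s; move=> /eqP; rewrite -subr_eq0 -rmorphM -(rmorph1 p) -rmorphB.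
  move=> /eqP/p0/(_ 1%N)[b]; rewrite expr1 => E.
  by apply: (Xnu (d - b)); rewrite mulrBr -E opprB addrC subrK.
exists S, (p X), n, phi; split.
- split.
  + move=> J /idealP[J0 JL].
    have JM a b : J b -> J (a * b) by move=> Jb; rewrite -[_ * _]addr0; apply: JL.
    have [Jtriv|] := pselect (forall s, J s -> s = 0).
      exists 0; rewrite ideal_gen1; apply/seteqP; split=> [s /Jtriv ->|_ [c _ <-]].
        by exists 0; rewrite ?mulr0.
      by rewrite mul0r.
    move=> /existsNP[s /not_implyP[Js /eqP/Snz[i [u [v [sE uv]]]]]].
    have JX : exists i, `[< J (p X ^+ i) >].
      exists i; apply/asboolP; rewrite -[_ ^+ _]mulr1 -uv mulrA -sE mulrC.
      exact: JM.
    have [k /asboolP Jk kmin] := ex_minnP JX.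
    exists (p X ^+ k); rewrite ideal_gen1; apply/seteqP; split=> [t Jt|_ [c _ <-]]; last first.
      by rewrite mulrC; apply: JM.
    have [->|/Snz[l [w [w' [tE ww']]]]] := eqVneq t 0; first by exists 0; rewrite ?mulr0.
    have lekl : (k <= l)%N.
      apply: kmin; apply/asboolP; rewrite -[_ ^+ _]mulr1 -ww' mulrA -tE mulrC.
      exact: JM.
    by exists (p X ^+ (l - k) * w) => //; rewrite mulrA -exprD subnKC.
  + have pXI : ideal (range ( *%R (p X))).
      rewrite -ideal_gen1; exact: (@span_submodule S S^o).
    have pXmax J : ideal J -> J <> setT -> J `<=` range ( *%R (p X)).
      move=> /idealP[J0 JL] JT s Js; have [->|] := eqVneq s 0; first by exists 0; rewrite ?mulr0.
      move=> /Snz[[|i] [u [v [sE uv]]]]; last first.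
        by exists (p X ^+ i * u) => //; rewrite mulrA -exprS.
      case: JT; apply/seteqP; split=> // t _.
      have -> : t = t * v * s + 0 by rewrite sE mul1r -mulrA [v * u]mulrC uv mulr1 addr0.
      exact: JL.
    have pXT : range ( *%R (p X)) <> setT.
      by move=> E; have [s _ /pX_nu] : range ( *%R (p X)) 1 by rewrite E.
    move=> J; rewrite ideal_gen1; split=> [[Jid JT Jmax]|->].
      by case: (Jmax _ pXI (pXmax _ Jid JT)).
    split=> // K Kid sub; have [->|KT] := pselect (K = setT); first by right.
    by left; apply/seteqP; split=> //; apply: pXmax.
  + rewrite ideal_gen1 => E; apply: pX_neq0.
    by have : range ( *%R (p X)) (p X) by [exists 1; rewrite ?mulr1]; rewrite E.
- by case: n fXn {nmin fI} => // /eqP; rewrite expr0 oner_eq0.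
- apply/seteqP; split => // r _; have [d <-] := fsurj r.
  by exists (p d).
- rewrite ideal_gen1; apply/seteqP; split=> [s /= s0|_ [c _ <-]]; last first.
    by rewrite /= rmorphM rmorphXn phiE fXn mul0r.
  have [->|/Snz[i [u [v [sE uv]]]]] := eqVneq s 0; first by exists 0; rewrite ?mulr0.
  have leni : (n <= i)%N.
    apply: nmin; rewrite -phiE -rmorphXn -[p X ^+ i]mulr1 -uv mulrA -sE.
    by rewrite rmorphM s0 mul0r.
  by exists (p X ^+ (i - n) * u) => //; rewrite mulrA -exprD subnKC.
Qed.

(** An Artinian local ring with maximal ideal [(x)]; [n] is the nilpotency index of [x], and also
    the length of the ring. *)
Definition chain_ring (R : comNzRingType) (x : R) (n : nat) : Prop :=
  [/\ forall r, (exists s, r = x * s) \/ (exists s, r * s = 1),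
      x ^+ n = 0 & forall i, x ^+ i = 0 -> (n <= i)%N].

(* Hungerford's consequence of Cohen's structure theorem. *)
Lemma chain_ring_hypersurface (R : comNzRingType) (x : R) (n : nat) :
  chain_ring x n -> artinian_hypersurface R.
Proof.
move=> [Rloc xn nmin].
have xnu s : x * s <> 1.
  move=> xs1; have /eqP := congr1 (fun a => a ^+ n) xs1.
  by rewrite exprMn xn mul0r expr1n eq_sym oner_eq0.
(* [None] is the variable for [X], and [Some r] the one for the lift [(Y (Some r), r)] of [r]. The
   base ring [Z[X]] involves none of the latter. *)
have [L [Y [E [Ering Ediv EY Yfree char0]]]] := exists_fresh_variables (option R).
pose W : comNzRingType := (L * R)%type.
pose X : W := (Y None, x).
pose nul : set W := [set w | w.1 = 0].
pose inM : set W := [set w | exists s, w.2 = x * s].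
have xunit r : (exists s, r * s = 1) -> ~ exists s, r = x * s.
  by move=> [t rt] [s rE]; apply: (xnu (s * t)); rewrite mulrA -rE.
have nul_prime : prime_ideal nul.
  split; rewrite /nul /=.
  - by [].
  - by apply/eqP; rewrite oner_eq0.
  - by move=> a b -> ->; rewrite subrr.
  - by move=> a b ->; rewrite mulr0.
  - by move=> a b /eqP; rewrite mulf_eq0 => /orP[]/eqP; [left|right].
have inM_prime : prime_ideal inM.
  split; rewrite /inM /=.
  - by exists 0; rewrite mulr0.
  - by apply: xunit; exists 1; rewrite mulr1.
  - by move=> a b [s ->] [t ->]; exists (s - t); rewrite mulrBr.
  - by move=> a b [s ->]; exists (a.2 * s); rewrite mulrCA.
  - move=> a b; case: (Rloc a.2) => [|[s as1]]; first by left.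
    case: (Rloc b.2) => [|[t bt1]]; first by right.
    by move/xunit; case; exists (s * t); rewrite mulrACA as1 bt1 mulr1.
have YNone0 : Y None <> 0.
  move=> Y0; have := Yfree None 'X; rewrite hornerX => /(_ _ Y0) X0.
  have /eqP : 'X = 0 :> {poly L} by apply: X0; rewrite -['X]expr1; apply: coefs_inXn.
  by rewrite polyX_eq0.
have X_nul : ~ nul X by [].
have X_inM : inM X by exists 1; rewrite mulr1.
have inv_exists s : ~ nul s -> ~ inM s -> exists t, s * t = 1.
  move=> s1 s2; case: (Rloc s.2) => // -[t st1]; exists (s.1^-1, t).
  by rewrite [LHS]surjective_pairing /= st1 mulfV //; apply/eqP.
have divX a : inM a -> exists z, X * z = a.
  move=> [s aE]; exists (a.1 / Y None, s).
  by rewrite [RHS]surjective_pairing [LHS]surjective_pairing /= -aE mulrC divfK //; apply/eqP.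
pose E' i : set W := [set w | E i w.1].
have E'ring i : subring (E' i).
  split; rewrite /E' /=; first exact: subring1.
    by move=> a b; apply: subringB.
  by move=> a b; apply: subringM.
have E'free i (y : W) (F : {poly W}) : y.1 = Y i -> coefs_in (E' i) F ->
    nul F.[y] -> coefs_in nul F.
  move=> yE EF nF; have F0 : map_poly fst F = 0.
    apply: (Yfree i) => [k|]; first by rewrite coef_map; apply: EF.
    by rewrite -yE horner_map.
  by move=> k; have := congr1 (fun P : {poly L} => P`_k) F0; rewrite coef_map coef0.
have [||G0good G0reg] := int_adjoin_regular (X := X) nul_prime inM_prime X_inM.
- by move=> k; rewrite /nul /= (rmorph_int fst) => /char0.
- move=> F ZF; apply: (E'free None) => // i; have [k _ <-] := ZF i.
  exact: subring_int.
have [||||||G [Ggood Gcomp Gloc Ghit]] := exists_complete_cover nul_prime inM_prime X_nul X_inM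
    inv_exists divX (I := R) (Y := fun r => (Y (Some r), r)) (E := fun r => E' (Some r))
    (hits := fun r => [set w | w.2 = r]) _ _ _ _ _ G0good G0reg _.
- by move=> r; apply: E'ring.
- by move=> r s w Es s0; apply: (Ediv (Some r) s.1).
- by move=> r s sr; apply: EY => -[].
- by move=> r F; apply: (E'free (Some r)).
- by [].
- move=> r; apply: adjoin_sub => //; last exact: EY.
  by move=> _ [k _ <-]; apply: subring_int.
have [Gring GX G0] := Ggood.
pose D : comNzRingType := subring_type Gring.
have GE := range_subring_val Gring.
pose v : {rmorphism D -> W} := (\val : D -> W).
have vinj : injective v by apply: val_inj.
have Gv d : G (v d) by rewrite -GE; exists d.
have lift g : G g -> exists d, v d = g by rewrite -{1}GE => -[d _ <-]; exists d.
have [XD XDE] := lift _ GX.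
pose f : {rmorphism D -> R} := (snd : {rmorphism W -> R}) \o v.
have fXD : f XD = x by rewrite -[x]/(X.2) -XDE.
apply: (@dvr_quotient D R XD f n).
- move=> b Xb0; apply: vinj; rewrite rmorph0.
  by apply: (good_mulX nul_prime X_nul Ggood) => //; rewrite -XDE -rmorphM Xb0 rmorph0.
- move=> b Xb1; apply: (xnu (f b)).
  by rewrite -fXD -rmorphM Xb1 rmorph1.
- move=> d; have [dM|dnM] := pselect (inM (v d)).
    left; have [g Gg gE] := Gcomp _ (Gv d) dM; have [b bE] := lift _ Gg.
    by exists b; apply: vinj; rewrite rmorphM XDE bE gE.
  right; have [g Gg gE] := Gloc _ (Gv d) dnM; have [b bE] := lift _ Gg.
  by exists b; apply: vinj; rewrite rmorphM bE gE rmorph1.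
- move=> r; have [w Gw wr] := Ghit r; have [d dE] := lift _ Gw.
  by exists d; rewrite -wr -dE.
- by rewrite fXD.
- by rewrite fXD.
Qed.

(** * Local rings and modules *)

Lemma exists_maximal_ideal (R : comNzRingType) (I : set R) :
  ideal I -> I <> setT -> exists2 J, maximal_ideal J & I `<=` J.
Proof.
move=> Iid IT; pose P J := [/\ ideal J, ~ J 1 & I `<=` J].
have noone J : ideal J -> J <> setT -> ~ J 1.
  move=> /idealP[J0 JL] JT J1; apply: JT; apply/seteqP; split=> // r _.
  by rewrite -[r]mulr1 -[_ * _]addr0; apply: JL.
have [|J [PJ Jmax]] := @Zorn_bigcup R (fun J => J = set0 \/ P J).
  move=> F FP totF; have [allF0|] := pselect (forall J, F J -> J = set0).
    by left; apply/seteqP; split => // w [J /allF0 ->].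
  move=> /existsNP[K /not_implyP[FK K0]]; right.
  have FP' J a : F J -> J a -> P J by move=> /FP[-> //|].
  have [K_id K1 IK] : P K by case: (FP _ FK).
  split; last by move=> a /IK Ka; exists K.
    apply/idealP; split.
      by exists K => //; case/idealP: K_id.
    move=> a u v [J1 F1 J1u] [J2 F2 J2v].
    have [sub|sub] := totF _ _ F1 F2.
      have [/idealP[_ JL] _ _] := FP' _ _ F2 J2v.
      by exists J2 => //; apply: JL => //; apply: sub.
    have [/idealP[_ JL] _ _] := FP' _ _ F1 J1u.
    by exists J1 => //; apply: JL => //; apply: sub.
  by move=> [J FJ J1]; have [] := FP' _ _ FJ J1.
have PI : P I by split => //; apply: noone.
have {}PJ : P J.
  case: PJ => // J0; case: (Jmax I); last by right.
  rewrite J0; split => // /(_ 0); apply.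
  by case/idealP: Iid.
have [Jid J1 IJ] := PJ; exists J => //; split => //; first by move=> JT; apply: J1; rewrite JT.
move=> K Kid JK; have [->|KT] := pselect (K = setT); first by right.
left; apply/seteqP; split => //; apply: contrapT => KJ; apply: (Jmax K) => //.
by right; split => //; [apply: noone | apply: subset_trans JK].
Qed.

Section LocalRing.
Variables (R : comNzRingType) (m : set R) (mloc : local_ring m).

Let mmax : maximal_ideal m. Proof. exact/mloc. Qed.

Lemma local_ideal : ideal m. Proof. by case: mmax. Qed.

Lemma local_not1 : ~ m 1.
Proof.
move=> m1; case: mmax => /idealP[m0 mL] + _; apply; apply/seteqP; split => // r _.
by rewrite -[r]mulr1 -[_ * _]addr0; apply: mL.
Qed.

Lemma local_unit r : ~ m r -> exists s, r * s = 1.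
Proof.
move=> mr; apply: contrapT => nu.
have rid : ideal (range ( *%R r)) by rewrite -ideal_gen1; apply: (@span_submodule R R^o).
have [E|J /mloc -> sub] := exists_maximal_ideal rid.
  by apply: nu; have [s _ sE] : range ( *%R r) 1 by [rewrite E]; exists s.
by apply/mr/sub; exists 1; rewrite ?mulr1.
Qed.

End LocalRing.

Section IdealOps.
Variables (R : comNzRingType) (I : set R) (Iid : ideal I).

Lemma ideal0 : I 0. Proof. by case/idealP: Iid. Qed.
Lemma idealMl a b : I b -> I (a * b).
Proof. by move=> Ib; rewrite -[_ * _]addr0; case/idealP: Iid => I0; apply. Qed.
Lemma idealMr a b : I a -> I (a * b). Proof. by rewrite mulrC; apply: idealMl. Qed.
Lemma idealD a b : I a -> I b -> I (a + b).
Proof. by move=> Ia Ib; rewrite -[a]mul1r; case/idealP: Iid => _; apply. Qed.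
Lemma idealN a : I a -> I (- a). Proof. by rewrite -mulN1r; apply: idealMl. Qed.
Lemma idealB a b : I a -> I b -> I (a - b).
Proof. by move=> Ia /idealN; apply: idealD. Qed.

End IdealOps.

Lemma exists_linear (R : comNzRingType) (A B : lmodType R) (f : A -> B) :
  (forall a u v, f (a *: u + v) = a *: f u + f v) ->
  exists g : {linear A -> B}, g =1 f.
Proof.
move=> flin; pose g : {linear A -> B} := HB.pack f (GRing.isLinear.Build R A B *:%R f flin).
by exists g.
Qed.

Section SubmoduleType.
Variables (R : comNzRingType) (M : lmodType R) (N : set M) (Nsub : submodule N).

Definition submodule_pred of submodule N : {pred M} := fun v => `[< N v >].

Let submodule_pred_closed : submod_closed (submodule_pred Nsub).
Proof.
have [N0 NL] := (submoduleP N).1 Nsub; split; first exact/asboolP.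
by move=> a u v /asboolP Nu /asboolP Nv; apply/asboolP; apply: NL.
Qed.

HB.instance Definition _ :=
  GRing.isSubmodClosed.Build R M (submodule_pred Nsub) submodule_pred_closed.

Record submodule_type := SubmoduleType {
  submodule_val :> M; submodule_valP : submodule_val \in submodule_pred Nsub }.

HB.instance Definition _ := [isSub for submodule_val].
HB.instance Definition _ := [Choice of submodule_type by <:].
HB.instance Definition _ := [SubChoice_isSubLmodule of submodule_type by <:].

Definition submodule_inj : {linear submodule_type -> M} := \val.

Lemma submodule_inj_injective : injective submodule_inj. Proof. exact: val_inj. Qed.

Lemma submodule_injP (w : submodule_type) : N (submodule_inj w).
Proof. exact/asboolP/submodule_valP. Qed.

Lemma submodule_lift v : N v -> exists w, submodule_inj w = v.
Proof.
move=> Nv; have Nv' : v \in submodule_pred Nsub by apply/asboolP.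
by exists (SubmoduleType Nv').
Qed.

End SubmoduleType.

Arguments submodule_inj {R M N Nsub}.

Section Isomorphic.
Variable R : comNzRingType.
Implicit Types M N A B : lmodType R.

Lemma isomorphic_sym M N : isomorphic M N -> isomorphic N M.
Proof.
move=> [f [g fK gK]]; have [|h hE] := @exists_linear R N M g.
  by move=> a u v; apply: (can_inj fK); rewrite gK linearP !gK.
by exists h; exists f => v; rewrite hE.
Qed.

Lemma injective_surjective_bijective (A B : Type) (f : A -> B) :
  injective f -> (forall b, exists a, f a = b) -> bijective f.
Proof.
by move=> finj /choice[g fgK]; exists g => // a; apply: finj; rewrite fgK.
Qed.

Lemma linear_injective M N (f : {linear M -> N}) :
  (forall u, f u = 0 -> u = 0) -> injective f.
Proof.
move=> f0 u v fuv; apply/eqP; rewrite -subr_eq0; apply/eqP/f0.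
by rewrite linearB fuv subrr.
Qed.

Definition multiples_of M (g : M) : set M := range (fun r : R => r *: g).

Lemma multiples_of_submodule M (g : M) : submodule (multiples_of g).
Proof.
apply/submoduleP; split; first by exists 0; rewrite ?scale0r.
by move=> a _ _ [r _ <-] [s _ <-]; exists (a * r + s) => //; rewrite scalerDl scalerA.
Qed.

Definition cyclic_submodule M (g : M) : lmodType R :=
  submodule_type (multiples_of_submodule g).

Lemma cyclic_isomorphic M N (g : M) (h : N) :
  (forall r : R, r *: g = 0 <-> r *: h = 0) ->
  isomorphic (cyclic_submodule g) (cyclic_submodule h).
Proof.
move=> gh; set A := cyclic_submodule g; set B := cyclic_submodule h.
have /choice[c cE] : forall w : A, exists r : R, submodule_inj w = r *: g.
  by move=> w; have [r _ <-] := submodule_injP w; exists r.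
have /choice[l lE] : forall r : R, exists w : B, submodule_inj w = r *: h.
  by move=> r; apply: submodule_lift; exists r.
have eqh r s : r *: g = s *: g <-> r *: h = s *: h.
  split=> /eqP; rewrite -subr_eq0 -scalerBl => /eqP/gh/eqP;
  by rewrite scalerBl subr_eq0 => /eqP.
have [|f fE] := @exists_linear R A B (fun w => l (c w)).
  move=> a u v; apply: submodule_inj_injective; rewrite linearP !lE scalerA -scalerDl.
  by apply/eqh; rewrite scalerDl -scalerA -!cE linearP.
exists f; apply: injective_surjective_bijective.
  move=> u v; rewrite !fE => /(congr1 submodule_inj).
  by rewrite !lE => /eqh; rewrite -!cE => /submodule_inj_injective.
move=> w; have [r _ rE] := submodule_injP w.
have [v vE] : exists v : A, submodule_inj v = r *: g by apply: submodule_lift; exists r.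
exists v; rewrite fE; apply: submodule_inj_injective; rewrite lE -rE.
by apply/eqh; rewrite -cE.
Qed.

Lemma fin_genP M : fin_gen M <->
  exists s : seq M, forall N : set M, submodule N -> {in s, forall g, N g} -> forall v, N v.
Proof.
split=> [[n [g gT]]|[s sgen]].
  exists (codom g) => N Nsub Ng v.
  have : span (range g) v by rewrite gT.
  by apply; split => // _ [i _ <-]; apply: Ng; apply: codom_f.
exists (size s), (fun i => s`_i); apply/seteqP; split => // v _.
apply: sgen; first exact: span_submodule.
move=> g /(nthP 0)[i ltis <-]; apply: sub_gen_smallest.
by exists (Ordinal ltis).
Qed.

Lemma fin_gen_image M N (f : {linear M -> N}) :
  (forall v, exists u, f u = v) -> fin_gen M -> fin_gen N.
Proof.
move=> fsurj /fin_genP[s sgen]; apply/fin_genP; exists (map f s) => K Ksub Ks v.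
have [u <-] := fsurj v; move: u; apply: (sgen (f @^-1` K)).
  have [K0 KL] := (submoduleP K).1 Ksub; apply/submoduleP; rewrite /preimage /=.
  split; first by rewrite linear0.
  by move=> a u v' Ku Kv; rewrite linearP; apply: KL.
by move=> g gs; apply: Ks; apply: map_f.
Qed.

Lemma fin_gen_cyclic M (g : M) : fin_gen (cyclic_submodule g).
Proof.
have [w wE] : exists w : cyclic_submodule g, submodule_inj w = g.
  by apply: submodule_lift; exists 1; rewrite ?scale1r.
apply/fin_genP; exists [:: w] => N /submoduleP[N0 NL] Nw v.
have [r _ rE] := submodule_injP v.
have -> : v = r *: w + 0 by apply: submodule_inj_injective; rewrite linearP linear0 addr0 wE.
by apply: NL => //; apply: Nw; rewrite inE.
Qed.

Lemma fin_gen_prod M N : fin_gen M -> fin_gen N -> fin_gen (M * N)%type.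
Proof.
move=> /fin_genP[s sgen] /fin_genP[t tgen]; apply/fin_genP.
exists ([seq (u, 0) | u <- s] ++ [seq (0, v) | v <- t]) => K /submoduleP[K0 KL] Kst [u v].
have -> : (u, v) = 1 *: (u, 0) + (0, v) :> (M * N)%type.
  by rewrite scale1r; congr pair; rewrite /= ?addr0 ?add0r.
apply: (KL).
  apply: (sgen [set u | K (u, 0)]) => [|g gs].
    apply/submoduleP; split=> // a x y Kx Ky.
    by have := KL a _ _ Kx Ky; congr K; congr pair; rewrite /= scaler0 addr0.
  by apply: Kst; rewrite mem_cat map_f.
apply: (tgen [set v | K (0, v)]) => [|g gs].
  apply/submoduleP; split=> // a x y Kx Ky.
  by have := KL a _ _ Kx Ky; congr K; congr pair; rewrite /= scaler0 addr0.
by apply: Kst; rewrite mem_cat map_f ?orbT.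
Qed.

End Isomorphic.

Section ExtensionClosed.
Variables (R : comNzRingType) (X : lmodType R -> Prop) (Xext : extension_closed X).
Implicit Types M N A B : lmodType R.

Lemma ext_iso M N : isomorphic M N -> X M -> X N.
Proof. by case: Xext => -[_ _ h] _ _; apply: h. Qed.

Lemma ext_fin_gen M : X M -> fin_gen M.
Proof. by case: Xext => -[h _ _] _ _; apply: h. Qed.

Lemma ext_prod A B : X A -> X B -> X (A * B)%type.
Proof.
move=> XA XB; case: Xext => _ _ ext.
have [|f fE] := @exists_linear R A (A * B)%type (fun a => (a, 0)).
  by move=> a u v; congr pair; rewrite /= scaler0 addr0.
have [//|g gE] := @exists_linear R (A * B)%type B snd.
apply: (ext A _ B f g) => //; first by apply: fin_gen_prod; apply: ext_fin_gen.
split.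
- by move=> u v; rewrite !fE => -[].
- apply/seteqP; split=> [_ [u _ <-]|[u v]].
    by rewrite /= gE fE.
  by rewrite /= gE /= => ->; exists u.
- by apply/seteqP; split=> // v _; exists (0, v).
Qed.

(** [N] is a summand of [M * N], which is isomorphic to [M]. *)
Lemma ext_zero M N : X M -> (forall v : N, v = 0) -> X N.
Proof.
move=> XM N0; case: Xext => _ summand _.
have [|f fE] := @exists_linear R M (M * N)%type (fun a => (a, 0)).
  by move=> a u v; congr pair; rewrite /= scaler0 addr0.
have [] // := summand M N; apply: ext_iso XM.
exists f; exists fst => [u|[u v]]; rewrite fE //.
by congr pair; rewrite /= [RHS]N0.
Qed.

End ExtensionClosed.

Lemma hypersurface_chain_ring (R : comNzRingType) :
  artinian_hypersurface R -> exists x n, chain_ring (x : R) n.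
Proof.
move=> [S [x [n [phi [[_ Sloc xne] n_gt0 phiT kerphi]]]]].
have ker s : phi s = 0 <-> exists c, s = x ^+ n * c.
  have -> : (phi s = 0) = (phi @^-1` [set 0]) s by [].
  by rewrite kerphi ideal_gen1; split=> [[c _ <-]|[c ->]]; exists c.
have x0 : x != 0.
  apply/eqP => x0; apply: xne; rewrite ideal_gen1 x0.
  by apply/seteqP; split=> [_ [c _ <-]|_ ->]; [rewrite /= mul0r | exists 0; rewrite ?mulr0].
have xnu c : x * c <> 1.
  by move=> xc1; apply: (local_not1 Sloc); rewrite ideal_gen1 -xc1; exists c.
exists (phi x), n; split.
- move=> r; have [s _ <-] : range phi r by rewrite phiT.
  have [[c sE]|xs] := pselect (exists c, s = x * c); first by left; exists (phi c); rewrite sE rmorphM.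
  right; have [|t st] := local_unit (r := s) Sloc.
    by rewrite ideal_gen1 => -[c _ cE]; apply: xs; exists c.
  by exists (phi t); rewrite -rmorphM st rmorph1.
- by rewrite -rmorphXn; apply/ker; exists 1; rewrite mulr1.
move=> i; rewrite -rmorphXn => /ker[c xi].
rewrite leqNgt; apply/negP => ltin; apply: (xnu (x ^+ (n - i).-1 * c)).
have E : 1 = x ^+ (n - i) * c.
  by apply: (mulfI (expf_neq0 i x0)); rewrite mulr1 mulrA -exprD subnKC // ltnW.
have d : ((n - i).-1.+1 = n - i)%N by rewrite prednK // subn_gt0.
by rewrite mulrA -exprS d -E.
Qed.

Section ChainRing.
Variables (R : comNzRingType) (x : R) (n : nat) (Rchain : chain_ring x n).
Implicit Types M N A B : lmodType R.

Lemma chain_ring_factor r : exists i u v, [/\ (i <= n)%N, u * v = 1 & r = x ^+ i * u].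
Proof.
case: Rchain => Rloc xn _.
have [r0|] := pselect (forall i, (i <= n)%N -> exists b, r = x ^+ i * b).
  (* Here [r] is zero, written as [x^n] times a unit. *)
  exists n, 1, 1; split; rewrite ?mulr1 //.
  by have [b ->] := r0 n (leqnn n); rewrite xn mul0r.
move=> /existsNP[i /not_implyP[lein nb]].
have : exists k, `[< ~ exists b, r = x ^+ k * b >] by exists i; apply/asboolP.
move=> /ex_minnP[[|k] /asboolP rk kmin]; first by case: rk; exists r; rewrite mul1r.
have [[b rE]|nk] := pselect (exists b, r = x ^+ k * b); last first.
  by have := kmin k (introT (asboolP _) nk); rewrite ltnn.
have ltkn : (k < n)%N by apply: leq_trans lein; apply: kmin; apply/asboolP.
case: (Rloc b) => [[c bE]|[v bv]]; first by case: rk; exists c; rewrite exprSr -mulrA -bE.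
by exists k, b, v; split=> //; apply: ltnW.
Qed.

Lemma chain_ring_annihilator M (v : M) :
  exists2 i, (i <= n)%N & forall r, r *: v = 0 <-> exists s, r = x ^+ i * s.
Proof.
case: (Rchain) => Rloc xn _.
have : exists i, `[< x ^+ i *: v = 0 >] by exists n; apply/asboolP; rewrite xn scale0r.
move=> /ex_minnP[i /asboolP xiv imin]; exists i.
  by apply: imin; apply/asboolP; rewrite xn scale0r.
move=> r; split=> [rv|[s ->]]; last by rewrite mulrC -scalerA xiv scaler0.
have [j [u [w [_ uw rE]]]] := chain_ring_factor r.
exists (x ^+ (j - i) * u); rewrite mulrA -exprD subnKC //.
apply: imin; apply/asboolP; move: rv; rewrite rE => rv.
by rewrite -[x ^+ j]mulr1 -uw mulrA mulrC -scalerA rv scaler0.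
Qed.

(* [R / (x ^ i)], realized as an ideal of [R] *)
Definition chain_cyclic i : lmodType R := @cyclic_submodule R R^o (x ^+ (n - i)).

Lemma chain_ringXn_eq0 i r : (i <= n)%N ->
  r * x ^+ (n - i) = 0 <-> exists s, r = x ^+ i * s.
Proof.
move=> lein; case: (Rchain) => Rloc xn nmin; split=> [rx|[s ->]]; last first.
  by rewrite mulrAC -exprD subnKC // xn mul0r.
have [k [u [w [_ uw rE]]]] := chain_ring_factor r.
exists (x ^+ (k - i) * u); rewrite mulrA -exprD subnKC //.
have : x ^+ (k + (n - i)) = 0.
  by rewrite exprD -[x ^+ k]mulr1 -uw mulrA -rE mulrAC rx mul0r.
by move=> /nmin; lia.
Qed.

Lemma cyclic_submodule_chain M (v : M) : exists2 i, (i <= n)%N &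
  (forall r, r *: v = 0 <-> exists s, r = x ^+ i * s) /\
  isomorphic (chain_cyclic i) (cyclic_submodule v).
Proof.
have [i lein iP] := chain_ring_annihilator v; exists i => //; split=> //.
apply: cyclic_isomorphic => r; rewrite -[_ *: _]/(r * x ^+ (n - i)).
by split=> [/(chain_ringXn_eq0 r lein)/iP|/iP/(chain_ringXn_eq0 r lein)].
Qed.

End ChainRing.

(** * Direct sums of cyclic modules *)

Section Families.
Variable R : comNzRingType.
Implicit Types M A B : lmodType R.

Definition generating M d (g : 'I_d -> M) : Prop :=
  forall v, exists c : 'I_d -> R, v = \sum_j c j *: g j.

(* [M] is the direct sum of the cyclic submodules [R g_j] *)
Definition direct_family M d (g : 'I_d -> M) : Prop :=
  forall c : 'I_d -> R, \sum_j c j *: g j = 0 -> forall j, c j *: g j = 0.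

Definition basis M d (g : 'I_d -> M) : Prop :=
  generating g /\ forall c : 'I_d -> R, \sum_j c j *: g j = 0 -> forall j, c j = 0.

Lemma basis_direct M d (g : 'I_d -> M) : basis g -> direct_family g.
Proof. by move=> [_ gfree] c /gfree c0 j; rewrite c0 scale0r. Qed.

Lemma fin_gen_generating M : fin_gen M -> exists d (g : 'I_d -> M), generating g.
Proof.
move=> [d [g gT]]; exists d, g => v.
have /(_ [set v | exists c : 'I_d -> R, v = \sum_j c j *: g j]) : span (range g) v by rewrite gT.
apply; split=> [|_ [i _ <-]].
  apply/submoduleP; split.
    by exists (fun=> 0); rewrite big1 // => j _; rewrite scale0r.
  move=> a _ _ [c ->] [e ->]; exists (fun j => a * c j + e j).
  rewrite scaler_sumr -big_split; apply: eq_bigr => j _.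
  by rewrite scalerDl scalerA.
exists (fun j => (j == i)%:R); rewrite (bigD1 i) //= eqxx scale1r big1 ?addr0 //.
by move=> j /negbTE ->; rewrite scale0r.
Qed.

Lemma fin_free_basis M : fin_free M <-> exists d (g : 'I_d -> M), basis g.
Proof.
split=> [[d /isomorphic_sym[f fbij]]|[d [g [ggen gfree]]]].
  have fsum (c : 'I_d -> R) : \sum_j c j *: f (delta_mx 0 j) = f (\row_j c j).
    rewrite [in RHS](row_sum_delta (\row_j c j)) linear_sum; apply: eq_bigr => j _.
    by rewrite linearZ mxE.
  exists d, (fun j => f (delta_mx 0 j)); split=> [v|c].
    have [h fK hK] := fbij; exists (fun j => h v 0 j); rewrite fsum.
    by rewrite -[v in LHS]hK; congr (f _); apply/rowP => j; rewrite mxE.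
  rewrite fsum -(linear0 f) => /(bij_inj fbij)/rowP c0 j.
  by have := c0 j; rewrite !mxE.
exists d; apply: isomorphic_sym.
have [|f fE] := @exists_linear R 'rV[R]_d M (fun c => \sum_j c 0 j *: g j).
  move=> a u v; rewrite scaler_sumr -big_split; apply: eq_bigr => j _.
  by rewrite !mxE scalerDl scalerA.
exists f; apply: injective_surjective_bijective.
  apply: linear_injective => u; rewrite fE => /gfree u0.
  by apply/rowP => j; rewrite mxE u0.
move=> v; have [c ->] := ggen v; exists (\row_j c j).
by rewrite fE; apply: eq_bigr => j _; rewrite mxE.
Qed.

(** The complement [B] of the first cyclic summand has a direct generating family with one element
    less, as inductions on [d] require. *)
Lemma split_direct M d (g : 'I_d.+1 -> M) : generating g -> direct_family g ->
  exists B (h : 'I_d -> B) (f : {linear B -> M}),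
  [/\ generating h /\ direct_family h, injective f /\ forall j, f (h j) = g (lift ord0 j),
      forall v, exists r b, v = r *: g ord0 + f b,
      forall r b, r *: g ord0 + f b = 0 -> r *: g ord0 = 0 /\ b = 0 &
      isomorphic (cyclic_submodule (g ord0) * B)%type M].
Proof.
move=> ggen gdir.
pose N : set M := range (fun c : 'I_d -> R => \sum_j c j *: g (lift ord0 j)).
have Nsub : submodule N.
  apply/submoduleP; split.
    by exists (fun=> 0) => //; rewrite big1 // => j _; rewrite scale0r.
  move=> a _ _ [c _ <-] [e _ <-]; exists (fun j => a * c j + e j) => //.
  rewrite scaler_sumr -big_split; apply: eq_bigr => j _.
  by rewrite scalerDl scalerA.
pose B : lmodType R := submodule_type Nsub.
pose f : {linear B -> M} := submodule_inj.
have finj : injective f by apply: submodule_inj_injective.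
have /choice[h hE] : forall j, exists b : B, f b = g (lift ord0 j).
  move=> j; apply: submodule_lift; exists (fun k => (k == j)%:R) => //.
  rewrite (bigD1 j) //= eqxx scale1r big1 ?addr0 // => k /negbTE ->.
  by rewrite scale0r.
have fh (c : 'I_d -> R) : f (\sum_j c j *: h j) = \sum_j c j *: g (lift ord0 j).
  by rewrite linear_sum; apply: eq_bigr => j _; rewrite linearZ_LR hE.
have hgen : generating h.
  move=> b; have [c _ cE] := submodule_injP b; exists c.
  by apply: finj; rewrite fh cE.
have fgen v : exists r b, v = r *: g ord0 + f b.
  have [c ->] := ggen v; exists (c ord0), (\sum_j c (lift ord0 j) *: h j).
  by rewrite big_ord_recl fh.
have fdir r b : r *: g ord0 + f b = 0 -> r *: g ord0 = 0 /\ b = 0.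
  have [c ->] := hgen b; rewrite fh => rb0.
  pose e j := oapp c r (unlift ord0 j).
  have /gdir e0 : \sum_j e j *: g j = 0.
    rewrite big_ord_recl /e unlift_none /= -[RHS]rb0; congr (_ + _).
    by apply: eq_bigr => j _; rewrite liftK.
  split; first by have := e0 ord0; rewrite /e unlift_none.
  apply: finj; rewrite fh linear0 big1 // => j _.
  by have := e0 (lift ord0 j); rewrite /e liftK.
exists B, h, f; split=> //.
  split=> // c c0 j; apply: finj; rewrite linear0 linearZ_LR hE.
  pose e k := oapp c 0 (unlift ord0 k).
  have /gdir/(_ (lift ord0 j)) : \sum_k e k *: g k = 0.
    rewrite big_ord_recl /e unlift_none /= scale0r add0r -[RHS](linear0 f) -c0 fh.
    by apply: eq_bigr => k _; rewrite liftK.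
  by rewrite /e liftK.
pose A := cyclic_submodule (g ord0).
have [|q qE] := @exists_linear R (A * B)%type M (fun ab => submodule_inj ab.1 + f ab.2).
  move=> a u v; rewrite -[(a *: u + v).1]/(a *: u.1 + v.1) -[(a *: u + v).2]/(a *: u.2 + v.2).
  by rewrite !linearP scalerDr addrACA.
exists q; apply: injective_surjective_bijective.
  apply: linear_injective => -[a b]; rewrite qE -[(a, b).1]/a -[(a, b).2]/b.
  have [r _ ra] := submodule_injP a; rewrite -ra => /fdir[r0 ->].
  by congr pair; apply: submodule_inj_injective; rewrite linear0; apply: etrans r0.
move=> v; have [r [b ->]] := fgen v.
have [a aE] : exists a : A, submodule_inj a = r *: g ord0.
  by apply: submodule_lift; exists r.
by exists (a, b); rewrite qE aE.
Qed.

Lemma ext_direct (X : lmodType R -> Prop) M d (g : 'I_d -> M) :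
  extension_closed X -> generating g -> direct_family g ->
  (forall j, X (cyclic_submodule (g j))) -> X M.
Proof.
move=> Xext; elim: d => [|d IHd] in M g *.
  move=> ggen _ _; case: (Xext) => -[_ [N XN] _] _ _; apply: (ext_zero Xext XN) => v.
  by have [c ->] := ggen v; rewrite big_ord0.
move=> ggen gdir Xg; have [B [h [f [[hgen hdir] [finj fh] _ _ iso]]]] := split_direct ggen gdir.
apply: (ext_iso Xext iso); apply: ext_prod => //; apply: IHd hgen hdir _ => j.
apply: (ext_iso Xext) (Xg (lift ord0 j)); apply: cyclic_isomorphic => r.
rewrite -fh -linearZ; split=> [rh|->]; last by rewrite linear0.
by apply: finj; rewrite rh linear0.
Qed.

End Families.

Section DirectFamily.
Variables (R : comNzRingType) (x : R) (n : nat) (Rchain : chain_ring x n).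

(* Minimize the sum of the orders of a fixed number of generators: a nontrivial
   relation [x^e (u g_0 + ...) = 0] with [u] a unit and [x^e g_0 <> 0] would let
   us replace [g_0] by an element of smaller order. *)
Lemma chain_ring_direct_family (M : lmodType R) : fin_gen M ->
  exists d (g : 'I_d -> M), generating g /\ direct_family g.
Proof.
move=> /fin_gen_generating[d [g0 g0gen]]; exists d; have [_ xn _] := Rchain.
pose bounded N (g : 'I_d -> M) (o : 'I_d -> nat) :=
  [/\ generating g, forall j, x ^+ o j *: g j = 0 & (\sum_j o j = N)%N].
have : exists N, `[< exists g o, bounded N g o >].
  exists (\sum_(j < d) n)%N; apply/asboolP; exists g0, (fun=> n); split=> // j.
  by rewrite xn scale0r.
move=> /ex_minnP[N /asboolP[g [o [ggen gord oN]]] Nmin]; exists g; split=> //.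
move=> c c0; apply: contrapT => /existsNP[j1 /eqP cj1].
have /choice[e /choice[u /choice[w euw]]] : forall j, exists i u w,
    [/\ (i <= n)%N, u * w = 1 & c j = x ^+ i * u].
  by move=> j; apply: chain_ring_factor.
pose J := [pred j | c j *: g j != 0].
have [j0 Jj0 emin] := @arg_minnP _ j1 J e cj1.
have eo j : J j -> (e j < o j)%N.
  move=> /eqP cg; rewrite ltnNge; apply/negP => leoe; apply: cg.
  have [_ _ ->] := euw j; rewrite -(subnKC leoe) exprD.
  by rewrite -mulrA mulrC -scalerA gord scaler0.
(* The nonzero terms of the relation, divided by [x^(e j0)]: by minimality of [e j0] no subtraction
   truncates, and the coefficient at [j0] is a unit. *)
pose b j := if J j then x ^+ (e j - e j0) * u j else 0.
have bj0 : b j0 * w j0 = 1.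
  by rewrite /b Jj0 subnn mul1r; have [] := euw j0.
pose h := \sum_j b j *: g j.
have xh : x ^+ e j0 *: h = 0.
  rewrite -[RHS]c0 scaler_sumr; apply: eq_bigr => j _; rewrite scalerA /b.
  case: ifP => [Jj|/negbFE/eqP ->]; last by rewrite mulr0 scale0r.
  rewrite mulrA -exprD subnKC; last exact: emin.
  by have [_ _ <-] := euw j.
pose g' j := if j == j0 then h else g j.
pose o' j := if j == j0 then e j0 else o j.
have ggen' : generating g'.
  move=> v; have [a ->] := ggen v.
  (* As [b j0] is a unit, [g j0] is a combination of [h] and the other generators. *)
  pose t := a j0 * w j0.
  exists (fun j => if j == j0 then t else a j - t * b j).
  rewrite (bigD1 j0) //= [in RHS](bigD1 j0) //= /g' !eqxx.
  rewrite /h [X in t *: X](bigD1 j0) //= scalerDr scalerA /t -mulrA [w j0 * _]mulrC bj0 mulr1.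
  rewrite -addrA; congr (_ + _); rewrite scaler_sumr -big_split; apply: eq_bigr => j /negbTE nj.
  by rewrite !nj /= scalerA -scalerDl addrC subrK.
have : (N <= \sum_j o' j)%N.
  apply: Nmin; apply/asboolP; exists g', o'; split=> // j.
  by rewrite /g' /o'; case: eqP.
have o'E : (\sum_(j < d | j != j0) o' j = \sum_(j < d | j != j0) o j)%N.
  by apply: eq_bigr => j /negbTE nj; rewrite /o' nj.
rewrite -oN (bigD1 j0) //= [in leqRHS](bigD1 j0) //= o'E /o' eqxx.
by rewrite leq_add2r leqNgt eo.
Qed.

End DirectFamily.

Lemma cyclic_submodule_map (R : comNzRingType) (a b c : R) :
  (exists s, c * a = s * b) ->
  exists f : {linear @cyclic_submodule R R^o a -> @cyclic_submodule R R^o b},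
    forall w, submodule_inj (f w) = c * (submodule_inj w : R).
Proof.
move=> [s sE].
have /choice[f fE] : forall w : @cyclic_submodule R R^o a,
    exists v : @cyclic_submodule R R^o b, submodule_inj v = c * (submodule_inj w : R).
  move=> w; apply: submodule_lift; have [r _ <-] := submodule_injP w.
  by exists (r * s) => //; rewrite -[LHS]/(r * s * b) -mulrA -sE mulrCA.
have [|g gE] := @exists_linear R _ _ f.
  move=> e u v; apply: submodule_inj_injective; rewrite linearP !fE linearP.
  by rewrite mulrDr mulrCA.
by exists g => w; rewrite gE.
Qed.

(** * Extension-closed subcategories over a chain ring *)

Section ChainRingExtensionClosed.
Variables (R : comNzRingType) (x : R) (n : nat) (Rchain : chain_ring x n).
Variables (X : lmodType R -> Prop) (Xext : extension_closed X).
Implicit Types M N A B : lmodType R.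
Local Notation C i := (chain_cyclic x n i).

Let cval i (w : C i) : R := submodule_inj w.

Let cval_inj i (u v : C i) : cval u = cval v -> u = v.
Proof. by move=> uv; apply: (@submodule_inj_injective R R^o _ _ u v uv). Qed.

Let cvalP i (w : C i) : exists r, cval w = r * x ^+ (n - i).
Proof. by have [r _ rE] := submodule_injP w; exists r; apply: esym rE. Qed.

Let cval0 i : cval (0 : C i) = 0. Proof. by rewrite /cval linear0. Qed.

Let clift i r : exists w : C i, cval w = r * x ^+ (n - i).
Proof. by apply: submodule_lift; exists r. Qed.

Let xnu s : x * s <> 1.
Proof.
case: Rchain => _ xn _ xs1; have /eqP := congr1 (fun a => a ^+ n) xs1.
by rewrite exprMn xn mul0r expr1n eq_sym oner_eq0.
Qed.

(** With [C i] realized as the ideal [(x^(n-i))], the injection of [R/x^i] into [R/x^(i+1)] becomes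
    an inclusion of ideals, and the projection back becomes multiplication by [x]. *)
Lemma chain_cyclic_maps i : (i < n)%N ->
  exists (inc : {linear C i -> C i.+1}) (mul : {linear C i.+1 -> C i}),
  (forall w, cval (inc w) = cval w) /\ (forall w, cval (mul w) = x * cval w).
Proof.
move=> ltin; have d : (n - i = (n - i.+1).+1)%N by lia.
have [|inc incE] := @cyclic_submodule_map R (x ^+ (n - i)) (x ^+ (n - i.+1)) 1.
  by exists x; rewrite mul1r d exprS.
have [|mul mulE] := @cyclic_submodule_map R (x ^+ (n - i.+1)) (x ^+ (n - i)) x.
  by exists 1; rewrite mul1r d exprS.
by exists inc, mul; split=> w; [rewrite /cval incE mul1r | exact: mulE].
Qed.

(* [0 -> R/x^i -> R/x^(i+1) * R/x^(i-1) -> R/x^i -> 0] *)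
Lemma chain_cyclic_descend i : (i.+1 < n)%N -> X (C i.+1) -> X (C i).
Proof.
move=> ltin XC; have [inc1 [mul1 [inc1E mul1E]]] := chain_cyclic_maps ltin.
have [inc0 [mul0 [inc0E mul0E]]] := chain_cyclic_maps (ltnW ltin).
have d1 : (n - i.+1 = (n - i.+2).+1)%N by lia.
have d0 : (n - i = (n - i.+2).+2)%N by lia.
have [|f fE] := @exists_linear R (C i.+1) (C i.+2 * C i)%type (fun w => (inc1 w, mul0 w)).
  by move=> a u v; congr pair; rewrite linearP.
have [|g gE] := @exists_linear R (C i.+2 * C i)%type (C i.+1) (fun w => mul1 w.1 - inc0 w.2).
  move=> a u v; rewrite -[(a *: u + v).1]/(a *: u.1 + v.1) -[(a *: u + v).2]/(a *: u.2 + v.2).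
  by rewrite !linearP addrACA -scalerDr.
have cvalB j (u v : C j) : cval (u - v) = cval u - cval v by rewrite /cval linearB.
have exact_fg : short_exact f g.
  split.
  - move=> u v; rewrite !fE => -[/(congr1 (@cval _)) + _].
    by rewrite !inc1E => /cval_inj.
  - apply/seteqP; split=> [_ [w _ <-]|[u v] /=].
      rewrite /preimage /= fE gE; apply: cval_inj.
      by rewrite cvalB mul1E inc0E mul0E inc1E subrr cval0.
    rewrite gE -[(u, v).1]/u -[(u, v).2]/v => /eqP; rewrite subr_eq0 => /eqP/(congr1 (@cval _)).
    rewrite mul1E inc0E; have [r uE] := cvalP u; have [s vE] := cvalP v.
    case: (Rchain) => Rloc _ nmin.
    case: (Rloc r) => [[t rE] uv|[t rt1] uv].
      have [w wE] := clift i.+1 t.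
      have uwE : cval u = cval w by rewrite uE wE rE d1 exprS; ring.
      exists w => //; rewrite fE; congr pair; apply: cval_inj.
        by rewrite inc1E.
      by rewrite mul0E -uwE.
    (* If [r] is a unit, [x u = v] shows that the unit [1 - x s t] kills [x^(n-i-1)], against the
       minimality of [n]. *)
    have unit1 : exists w, (1 - x * (s * t)) * w = 1.
      case: (Rloc (1 - x * (s * t))) => // -[w E]; case: (xnu (s := s * t + w)).
      by rewrite mulrDr -E addrC subrK.
    have [w w1] := unit1.
    have : x ^+ (n - i.+1) = 0.
      rewrite -[LHS]mulr1 -w1 [LHS]mulrA.
      suff -> : x ^+ (n - i.+1) * (1 - x * (s * t)) = 0 by rewrite mul0r.
      move: uv; rewrite uE vE d0 d1 !exprS => uv.
      have -> : x * x ^+ (n - i.+2) * (1 - x * (s * t)) =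
          x * x ^+ (n - i.+2) - t * (s * (x * (x * x ^+ (n - i.+2)))) by ring.
      rewrite -uv; have -> : t * (x * (r * x ^+ (n - i.+2))) = (r * t) * (x * x ^+ (n - i.+2)) by ring.
      by rewrite rt1 mul1r subrr.
    by move=> /nmin; lia.
  - apply/seteqP; split=> // w _; have [r wE] := cvalP w; have [u uE] := clift i.+2 r.
    exists (u, 0) => //; apply: cval_inj.
    by rewrite gE cvalB mul1E inc0E uE wE cval0 subr0 d1 exprS; ring.
case: (Xext) => _ summand ext.
have XE : X (C i.+2 * C i)%type.
  by apply: (ext _ _ _ f g _ exact_fg XC XC); apply: fin_gen_prod; apply: fin_gen_cyclic.
by case: (summand _ _ XE).
Qed.

(* [0 -> R/x -> R/x^(i+1) -> R/x^i -> 0] *)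
Lemma chain_cyclic_ascend i : (i < n)%N -> X (C 1) -> X (C i) -> X (C i.+1).
Proof.
move=> ltin XC1 XCi; have [_ [mul [_ mulE]]] := chain_cyclic_maps ltin.
have d : (n - i = (n - i.+1).+1)%N by lia.
have [|inc incE'] := @cyclic_submodule_map R (x ^+ (n - 1)) (x ^+ (n - i.+1)) 1.
  by exists (x ^+ i); rewrite mul1r -exprD; congr (_ ^+ _); lia.
have incE w : cval (inc w : C i.+1) = cval (w : C 1) by rewrite /cval incE' mul1r.
case: (Xext) => _ _ ext.
apply: (ext (C 1) (C i.+1) (C i) inc mul) => //; first exact: fin_gen_cyclic.
split.
- by move=> u v /(congr1 (@cval _)); rewrite !incE => /cval_inj.
- apply/seteqP; split=> [_ [w _ <-]|u].
    apply: cval_inj; rewrite mulE incE cval0; have [r ->] := cvalP w.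
    have d1 : ((n - 1).+1 = n)%N by lia.
    by rewrite mulrCA -exprS d1; case: Rchain => _ -> _; rewrite mulr0.
  move=> /= /(congr1 (@cval _)); rewrite mulE cval0.
  have [r uE] := cvalP u; rewrite uE mulrCA -exprS -d.
  move=> /(chain_ringXn_eq0 Rchain r (ltnW ltin))[s rE].
  have [w wE] := clift 1 s; exists w => //; apply: cval_inj.
  have d1 : (n - 1 = i + (n - i.+1))%N by lia.
  by rewrite incE wE uE rE d1 exprD; ring.
- apply/seteqP; split=> // w _; have [r wE] := cvalP w; have [u uE] := clift i.+1 r.
  exists u => //; apply: cval_inj.
  by rewrite mulE uE wE mulrCA -exprS -d.
Qed.

(** Cyclic summands are split off one at a time. One with annihilator [(x^i)] vanishes for [i = 0],
    extends the basis for [i = n], and otherwise gives the second alternative. *)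
Lemma basis_or_cyclic d M (g : 'I_d -> M) : generating g -> direct_family g -> X M ->
  (exists k (h : 'I_k -> M), basis h) \/ exists2 i, (0 < i < n)%N & X (C i).
Proof.
elim: d => [|d IHd] in M g *.
  by move=> ggen _ _; left; exists 0%N, g; split=> // c _ [].
move=> ggen gdir XM; have [B [h [f [[hgen hdir] [finj fh] fgen fdir iso]]]] := split_direct ggen gdir.
case: (Xext) => _ summand _.
have [XA XB] := summand _ _ (ext_iso Xext (isomorphic_sym iso) XM).
have [i lein [iP isoC]] := cyclic_submodule_chain Rchain (g ord0).
have [[k [e [egen efree]]]|] := IHd _ _ hgen hdir XB; last by right.
have XCi : X (C i) by apply: (ext_iso Xext) (isomorphic_sym isoC) XA.
have fsum (c : 'I_k -> R) : f (\sum_j c j *: e j) = \sum_j c j *: f (e j).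
  by rewrite linear_sum; apply: eq_bigr => j _; rewrite linearZ_LR.
have [i0|i_gt0] := posnP i.
  have g0 : g ord0 = 0.
    by rewrite -[LHS]scale1r; apply/iP; exists 1; rewrite i0 mulr1.
  left; exists k, (f \o e); split=> [v|c].
    have [r [b ->]] := fgen v; have [c ->] := egen b; exists c.
    by rewrite g0 scaler0 add0r fsum.
  by rewrite -fsum -(linear0 f) => /finj /efree.
have [ltin|] := ltnP i n; first by right; exists i => //; rewrite i_gt0.
move=> leni; have in_ : i = n by apply/eqP; rewrite eqn_leq lein.
left; exists k.+1, (fun j => oapp (f \o e) (g ord0) (unlift ord0 j)).
have bsum (c : 'I_k.+1 -> R) :
    \sum_j c j *: oapp (f \o e) (g ord0) (unlift ord0 j) =
    c ord0 *: g ord0 + f (\sum_j c (lift ord0 j) *: e j).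
  rewrite big_ord_recl unlift_none fsum; congr (_ + _).
  by apply: eq_bigr => j _; rewrite liftK.
split=> [v|c].
  have [r [b ->]] := fgen v; have [c ->] := egen b.
  exists (fun j => oapp c r (unlift ord0 j)); rewrite bsum unlift_none /=; congr (_ + f _).
  by apply: eq_bigr => j _; rewrite liftK.
rewrite bsum => /fdir[r0 /efree c0] j; case: (unliftP ord0 j) => [l|] ->; first exact: c0.
by have [s ->] := (iP _).1 r0; rewrite in_; case: Rchain => _ -> _; rewrite mul0r.
Qed.

End ChainRingExtensionClosed.

Lemma chain_ring_only_trivial (R : comNzRingType) (x : R) n :
  chain_ring x n -> only_trivial_extension_closed R.
Proof.
move=> Rchain X Xext; have [_ xn nmin] := Rchain.
have [triv|] := pselect (forall M, X M -> forall v : M, v = 0).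
  constructor 1 => M; split=> [/triv//|M0].
  by have [[_ [N XN] _] _ _] := Xext; apply: ext_zero XN M0.
move=> /existsNP[M0 /not_implyP[XM0 /existsNP[v0 v0_neq0]]].
have [[i /andP[i_gt0 ltin] XCi]|noC] :=
    pselect (exists2 i, (0 < i < n)%N & X (chain_cyclic x n i)).
  have XC1 : X (chain_cyclic x n 1).
    case: i i_gt0 ltin XCi => // i _; elim: i => // i IHi ltin XC.
    by apply: IHi; [apply: ltnW | apply: chain_cyclic_descend XC].
  have XC j : (j <= n)%N -> X (chain_cyclic x n j).
    elim: j => [_|j IHj ltjn]; last first.
      by apply: chain_cyclic_ascend => //; apply: IHj; apply: ltnW.
    apply: (ext_zero Xext XC1) => w; apply: submodule_inj_injective.
    have [r _ rE] := submodule_injP w; rewrite linear0; apply: etrans (esym rE) _.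
    by rewrite subn0 xn scaler0.
  constructor 3 => M; split=> [|Mfin]; first exact: ext_fin_gen.
  have [d [g [ggen gdir]]] := chain_ring_direct_family Rchain Mfin.
  apply: (ext_direct Xext ggen gdir) => j.
  have [k lekn [_ iso]] := cyclic_submodule_chain Rchain (g j).
  by apply: (ext_iso Xext iso); apply: XC.
have free M : X M -> exists d (g : 'I_d -> M), basis g.
  move=> XM; have Mfin := ext_fin_gen Xext XM.
  have [d [g [ggen gdir]]] := chain_ring_direct_family Rchain Mfin.
  by case: (basis_or_cyclic Rchain Xext ggen gdir XM).
have iso_top (N : lmodType R) d (g : 'I_d -> N) j : basis g ->
    isomorphic (chain_cyclic x n n) (cyclic_submodule (g j)).
  move=> [_ gfree]; have [i lein [iP iso]] := cyclic_submodule_chain Rchain (g j).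
  suff iE : i = n by rewrite iE in iso.
  apply/eqP; rewrite eqn_leq lein nmin //.
  have xig : x ^+ i *: g j = 0 by apply/iP; exists 1; rewrite mulr1.
  pose c k := if k == j then x ^+ i else 0.
  have /gfree/(_ j) : \sum_k c k *: g k = 0.
    rewrite (bigD1 j) //= /c eqxx xig add0r big1 // => k /negbTE ->.
    by rewrite scale0r.
  by rewrite /c eqxx.
(* A nonzero member is free of positive rank, so a copy of [R] is a summand of it. *)
have XCn : X (chain_cyclic x n n).
  have [[|d] [g gbasis]] := free _ XM0.
    by case: v0_neq0; have [c ->] := gbasis.1 v0; rewrite big_ord0.
  have [B [h [f [_ _ _ _ iso]]]] := split_direct gbasis.1 (basis_direct gbasis).
  have [_ summand _] := Xext.
  have [XA _] := summand _ _ (ext_iso Xext (isomorphic_sym iso) XM0).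
  exact: (ext_iso Xext) (isomorphic_sym (iso_top _ _ _ _ gbasis)) XA.
constructor 2 => M; split=> [/free/fin_free_basis//|/fin_free_basis[d [g gbasis]]].
apply: (ext_direct Xext gbasis.1 (basis_direct gbasis)) => j.
exact: (ext_iso Xext (iso_top _ _ _ _ gbasis)).
Qed.

(** * Gorenstein and stretched artinian local rings *)

Lemma zero_ideal (R : comNzRingType) : ideal [set (0 : R)].
Proof. by apply/idealP; split=> // a _ _ -> ->; rewrite mulr0 addr0. Qed.

Section ArtinianLocal.
Variables (R : comNzRingType) (m : set R).
Hypotheses (mloc : local_ring m) (Rart : artinian R).

Let mid : ideal m. Proof. exact: local_ideal mloc. Qed.

Lemma local_unit_1B a : m a -> exists b, (1 - a) * b = 1.
Proof.
move=> ma; apply: (local_unit mloc) => m1a; apply: (local_not1 mloc).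
by rewrite -(subrK a 1); apply: idealD.
Qed.

Lemma local_kill (N : set R) a b : ideal N -> m a -> N ((1 - a) * b) -> N b.
Proof.
move=> Nid ma Nab; have [c c1] := local_unit_1B ma.
by rewrite -[b]mul1r -c1 mulrAC mulrC; apply: idealMl.
Qed.

Lemma range_mul_ideal (a : R) : ideal (range ( *%R a)).
Proof. by rewrite -ideal_gen1; apply: (@span_submodule R R^o). Qed.

(** Multiply [c] by elements of [m] as long as the product stays outside [N]. The principal ideals
    obtained descend; where they stabilize, [local_kill] puts the product into [N]. *)
Lemma exists_socle (N : set R) c : ideal N -> ~ N c ->
  exists r, ~ N (r * c) /\ forall a, m a -> N (a * (r * c)).
Proof.
move=> Nid Nc; apply: contrapT => noS.
have /choice[mu muP] : forall r, exists a, ~ N (r * c) -> m a /\ ~ N (a * (r * c)).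
  move=> r; have [Nr|nNr] := pselect (N (r * c)); first by exists 0.
  apply: contrapT => noa; apply: noS; exists r; split=> // a ma; apply: contrapT => Na.
  by apply: noa; exists a.
pose r_ i := iter i (fun r => mu r * r) 1.
have rN i : ~ N (r_ i * c).
  elim: i => [|i IHi]; first by rewrite mul1r.
  by have [_] := muP _ IHi; rewrite mulrA.
pose I i := range ( *%R (r_ i * c)).
have Iid i : ideal (I i) by apply: range_mul_ideal.
have Isub i : I i.+1 `<=` I i.
  move=> _ [s _ <-]; exists (mu (r_ i) * s) => //.
  by rewrite /r_ iterS -/(r_ i); ring.
have [k /(_ k.+1 (leqnSn k)) E] := Rart Iid Isub.
have [t _ tE] : I k.+1 (r_ k * c) by rewrite E; exists 1; rewrite ?mulr1.
apply: (rN k); apply: (@local_kill N (mu (r_ k) * t)) => //.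
  by apply: idealMr => //; have [] := muP _ (rN k).
have -> : (1 - mu (r_ k) * t) * (r_ k * c) = r_ k * c - (r_ k.+1 * c) * t.
  by rewrite /r_ iterS -/(r_ k); ring.
by rewrite tE subrr; apply: ideal0.
Qed.

End ArtinianLocal.

(** * Nakayama's lemma and lengths of ideals *)

Section FiniteLength.
Variables (R : comNzRingType) (m : set R) (l : nat).
Hypotheses (mloc : local_ring m) (Rlen : @has_length R R^o l).

Let mid : ideal m. Proof. exact: local_ideal mloc. Qed.

(** Noetherian induction: successive counterexamples would form a strict chain longer than [l]. *)
Lemma ideal_ind (P : set R -> Prop) :
  (forall N, ideal N -> (forall N', ideal N' -> N `<` N' -> P N') -> P N) ->
  forall N, ideal N -> P N.
Proof.
move=> IH N0 N0id; apply: contrapT => nP0.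
have /choice[next nextP] : forall N, exists N', ideal N /\ ~ P N ->
    [/\ ideal N', ~ P N' & N `<` N'].
  move=> N; have [[Nid nP]|no] := pselect (ideal N /\ ~ P N); last by exists N => /no.
  apply: contrapT => noN'; apply: nP; apply: IH => // N' N'id NN'.
  by apply: contrapT => nP'; apply: noN'; exists N'.
pose C i := iter i next N0.
have Cok i : ideal (C i) /\ ~ P (C i) by elim: i => // i /nextP[].
have [_ /(_ l.+1 C)] := Rlen; rewrite ltnn => too_long.
suff : false by []; apply: too_long.
by split=> i _; [case: (Cok i) | case: (nextP _ (Cok i))].
Qed.

Lemma ideal_add_ideal (N : set R) b : ideal N ->
  ideal [set a + r * b | a in N & r in setT].
Proof.
move=> Nid; apply/idealP; split.
  by exists 0; [apply: ideal0 | exists 0; rewrite // mul0r addr0].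
move=> c _ _ [a Na [r _ <-]] [a' Na' [r' _ <-]].
exists (c * a + a'); first by apply: idealD => //; apply: idealMl.
by exists (c * r + r') => //; ring.
Qed.

Lemma ideal_mul_ideal (I J : set R) : ideal (ideal_mul I J).
Proof. exact: (@span_submodule R R^o). Qed.

Lemma ideal_mul_sub (I J K : set R) : ideal K ->
  (forall a b, I a -> J b -> K (a * b)) -> ideal_mul I J `<=` K.
Proof. by move=> Kid IJK; apply: smallest_sub => // _ [a Ia [b Jb <-]]; apply: IJK. Qed.

Lemma ideal_mul_mem (I J : set R) a b : I a -> J b -> ideal_mul I J (a * b).
Proof. by move=> Ia Jb; apply: sub_gen_smallest; exists a => //; exists b. Qed.

(** Induction on [N] takes the place of generators of [J]. For [g] in [J] outside [N] it puts [J]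
    inside [N + R g], hence [g] in [N + m g], and [1 - r] is a unit for [r] in [m]. *)
Lemma nakayama (J N : set R) : ideal J -> ideal N ->
  (forall v, J v -> exists a b, [/\ ideal_mul m J a, N b & v = a + b]) -> J `<=` N.
Proof.
move=> Jid; move: N; apply: ideal_ind => N Nid IH JmN g Jg; apply: contrapT => Ng.
pose N' := [set a + r * g | a in N & r in setT].
have NN' : N `<=` N' by move=> a Na; exists a => //; exists 0; rewrite // mul0r addr0.
have N'g : N' g by exists 0; [apply: ideal0 | exists 1; rewrite // mul1r add0r].
have JN' : J `<=` N'.
  apply: IH; [exact: ideal_add_ideal | by split=> // /(_ _ N'g) |].
  by move=> v /JmN[a [b [Ja Nb ->]]]; exists a, b; split=> //; apply: NN'.
have Kid : ideal [set a + r * g | a in N & r in m].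
  apply/idealP; split.
    by exists 0; [apply: ideal0 | exists 0; rewrite ?mul0r ?addr0 //; apply: ideal0].
  move=> c _ _ [a Na [r mr <-]] [a' Na' [r' mr' <-]].
  exists (c * a + a'); first by apply: idealD => //; apply: idealMl.
  by exists (c * r + r'); [apply: idealD => //; apply: idealMl | ring].
have [a [b [Ja Nb gE]]] := JmN _ Jg.
have [a' Na' [r mr aE]] : [set a + r * g | a in N & r in m] a.
  apply: (ideal_mul_sub Kid) Ja => c d mc /JN'[a' Na' [r _ <-]].
  exists (c * a'); first exact: idealMl.
  by exists (c * r); [apply: idealMr | ring].
apply: Ng; apply: (local_kill mloc Nid mr).
have -> : (1 - r) * g = a' + b by rewrite mulrBl mul1r {1}gE -aE; ring.
exact: idealD.
Qed.

(** A lower bound [p] for the length of [N], which is all that counting against [l] requires. *)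
Definition long (N : set R) p : Prop :=
  exists2 C, @submodule_chain R R^o p C & C p `<=` N.

Lemma long0 (N : set R) : ideal N -> long N 0.
Proof. by move=> Nid; exists (fun=> N). Qed.

Lemma longW (N N' : set R) p : N `<=` N' -> long N p -> long N' p.
Proof. by move=> NN' [C Cchain CN]; exists C => //; apply: subset_trans NN'. Qed.

Lemma longS (N N' : set R) p : ideal N' -> N `<` N' -> long N p -> long N' p.+1.
Proof.
move=> N'id [NN' nN'] [C [Cid Clt] CN]; exists (fun i => if (i <= p)%N then C i else N').
  split=> i; first by case: ifP => [lt _|_ _ //]; apply: Cid.
  rewrite ltnS => lt; rewrite lt; case: ltnP => [ltip|]; first exact: Clt.
  move=> lepi; have -> : i = p by apply/eqP; rewrite eqn_leq lt.
  by split; [apply: subset_trans NN' | move=> sub; apply: nN'; apply: subset_trans CN].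
by rewrite ltnn.
Qed.

Lemma long_length p : long setT p -> (p <= l)%N.
Proof. by case=> C Cchain _; case: Rlen => _; apply; exact: Cchain. Qed.

(** By Nakayama's lemma, fewer than [q] elements cannot generate [J] modulo [m J]; so [q] strict
    steps lead up from [m J] by adjoining elements of [J]. *)
Lemma long_generators (J : set R) p q : ideal J ->
  (forall k, (k < q)%N -> ~ @generated_by R R^o J k) ->
  long (ideal_mul m J) p -> long J (p + q).
Proof.
move=> Jid Jgen Jp.
pose sum (s : seq R) := ideal_gen (ideal_mul m J `|` [set g | g \in s]).
have sum_ideal s : ideal (sum s) by apply: (@span_submodule R R^o).
have sub_sum s : ideal_mul m J `|` [set g | g \in s] `<=` sum s by apply: sub_gen_smallest.
have mulJ : ideal_mul m J `<=` J.
  by apply: ideal_mul_sub => // a b _; apply: idealMl.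
have [s [szs Js sumq]] : exists s : seq R, [/\ size s = q, {in s, forall g, J g} & long (sum s) (p + q)].
  elim: q Jgen => [|q IHq] Jgen.
    exists [::]; split=> //; rewrite addn0; apply: longW Jp => a Ja.
    by apply: sub_sum; left.
  have [|s [szs Js sumq]] := IHq; first by move=> k ltkq; apply: Jgen; apply: ltnW.
  have [g [Jg ng]] : exists g, J g /\ ~ sum s g.
    apply: contrapT => nog; apply: (Jgen q (ltnSn q)).
    exists (fun i => s`_i); apply/seteqP; split.
      apply: smallest_sub => // _ [i _ <-]; apply: Js.
      by apply: mem_nth; rewrite szs.
    apply: nakayama => //; first exact: (@span_submodule R R^o).
    set N := span _; have Nid : ideal N by apply: (@span_submodule R R^o).
    move=> v Jv; have : sum s v by apply: contrapT => nv; apply: nog; exists v.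
    have Kid : ideal [set a + b | a in ideal_mul m J & b in N].
      have mJid := ideal_mul_ideal m J.
      apply/idealP; split; first by exists 0; [exact: (ideal0 mJid) | exists 0; [exact: (ideal0 Nid) | rewrite addr0]].
      move=> c _ _ [a Ja [b Nb <-]] [a' Ja' [b' Nb' <-]].
      exists (c * a + a'); first by apply: (idealD mJid) => //; apply: (idealMl mJid).
      exists (c * b + b'); first by apply: (idealD Nid) => //; apply: (idealMl Nid).
      by ring.
    move=> /(smallest_sub Kid)[]; last by move=> a Ja [b Nb <-]; exists a, b.
    move=> g [Ja|/= /(nthP 0)[i ltis <-]].
      by exists g => //; exists 0; [exact: (ideal0 Nid) | rewrite addr0].
    exists 0; first exact: (ideal0 (ideal_mul_ideal m J)).
    exists s`_i; last by rewrite add0r.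
    apply: sub_gen_smallest; rewrite szs in ltis.
    by exists (Ordinal ltis).
  exists (g :: s); split=> /=; first by rewrite szs.
    by move=> h; rewrite inE => /predU1P[->//|/Js].
  rewrite addnS; apply: longS (sum_ideal _) _ sumq; split.
    apply: (smallest_sub (sum_ideal _)) => h [Jh|/= hs]; apply: sub_sum; first by left.
    by right; rewrite /= inE hs orbT.
  move=> sub; apply: ng; apply: sub; apply: sub_sum; right.
  by rewrite /= mem_head.
apply: longW sumq; apply: smallest_sub => // g [/mulJ//|/=].
exact: Js.
Qed.

End FiniteLength.

(* Baer's criterion; a morphism [N -> K] is encoded as a function on [R] that is
   linear on [N]. *)
Definition ideal_injective (R : comNzRingType) (K : lmodType R) : Prop :=
  forall (N : set R) (f : R -> K), ideal N ->
    (forall a u v, N u -> N v -> f (a * u + v) = a *: f u + f v) ->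
    exists k, forall a, N a -> f a = a *: k.

Lemma injective_ideal_injective (R : comNzRingType) (K : lmodType R) :
  injective_module K -> ideal_injective K.
Proof.
move=> Kinj N f Nid flin; have Nsub : @submodule R R^o N by [].
pose A : lmodType R := submodule_type Nsub.
have [|g gE] := @exists_linear R A K (fun a => f (submodule_inj a)).
  by move=> a u v; rewrite linearP; apply: flin; apply: (submodule_injP (M := R^o)).
have [h hE] := Kinj A R^o submodule_inj g (@submodule_inj_injective _ _ _ Nsub).
exists (h 1) => a Na; have [w wE] := submodule_lift Nsub Na.
have := hE w; rewrite gE wE => <-.
by rewrite -linearZ_LR; congr (h _); rewrite -[LHS]mulr1.
Qed.

(** * Finite injective dimension over an Artinian local ring *)

Section InjectiveDimension.
Variables (R : comNzRingType) (m : set R) (l : nat).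
Hypotheses (mloc : local_ring m) (Rart : artinian R) (Rlen : @has_length R R^o l).

Let mid : ideal m. Proof. exact: local_ideal mloc. Qed.

(* An element [p] of the socle of [K] gives the morphism
   [N + R b -> (N + R b) / N = R/m -> K]. *)
Lemma ideal_injective_socle (K : lmodType R) (N : set R) b (p : K) :
  ideal_injective K -> ideal N -> ~ N b -> (forall a, m a -> N (a * b)) ->
  (forall a, m a -> a *: p = 0) ->
  exists k, (forall a, N a -> a *: k = 0) /\ b *: k = p.
Proof.
move=> Kinj Nid Nb mb mp.
pose N' := [set a + r * b | a in N & r in setT].
have N'id : ideal N' by apply: ideal_add_ideal.
have /choice[c cP] : forall v, exists r, N' v -> N (v - r * b).
  move=> v; have [[a Na [r _ <-]]|nv] := pselect (N' v); last by exists 0 => /nv.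
  by exists r; rewrite addrK.
have p0 r : N (r * b) -> r *: p = 0.
  move=> Nrb; apply: mp; apply: contrapT => /(local_unit mloc)[s rs]; apply: Nb.
  by rewrite -[b]mul1r -rs mulrAC mulrC; apply: idealMl.
have cE v r : N' v -> N (v - r * b) -> c v *: p = r *: p.
  move=> N'v Nvr; apply/eqP; rewrite -subr_eq0 -scalerBl; apply/eqP/p0.
  have -> : (c v - r) * b = (v - r * b) - (v - c v * b) by ring.
  by apply: idealB => //; apply: cP.
have [|k kP] := Kinj N' (fun v => c v *: p) N'id.
  move=> a u v N'u N'v; rewrite scalerA -scalerDl; apply: cE.
    by apply: idealD => //; apply: idealMl.
  have -> : a * u + v - (a * c u + c v) * b = a * (u - c u * b) + (v - c v * b) by ring.
  by apply: idealD => //; [apply: idealMl => //|]; apply: cP.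
have NN' a : N a -> N' a by move=> Na; exists a => //; exists 0; rewrite // mul0r addr0.
have N'b : N' b by exists 0; [apply: ideal0 | exists 1; rewrite // mul1r add0r].
exists k; split=> [a Na|].
  by rewrite -kP ?(cE a 0) ?scale0r ?mul0r ?subr0 //; apply: NN'.
by rewrite -kP // (cE b 1) ?scale1r // mul1r subrr; apply: ideal0.
Qed.

(** This lets an injective resolution be shortened down to length zero. The point is that an element
    of [J] killed by [N] lifts to an element of [I] killed by [N]. *)
Lemma ideal_injective_cosyzygy (K I J : lmodType R) (f : {linear K -> I}) (g : {linear I -> J}) :
  short_exact f g -> ideal_injective I -> ideal_injective J -> ideal_injective K.
Proof.
move=> [finj fg gT] Iinj Jinj.
have gsurj j : exists i, g i = j by have [i _ <-] : range g j by [rewrite gT]; exists i.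
have fker i : g i = 0 -> exists k, f k = i.
  by move=> gi0; have [k _ <-] : range f i by [rewrite fg]; exists k.
have gf k : g (f k) = 0 by have : (g @^-1` [set 0]) (f k) by [rewrite -fg; exists k].
have one_neq0 : (1 : R) <> 0 by apply/eqP/oner_neq0.
have [r [s_neq0 ms]] := exists_socle mloc Rart (zero_ideal R) one_neq0.
set s := r * 1 in s_neq0 ms.
have lift_killed : forall N, ideal N -> forall j : J, (forall a, N a -> a *: j = 0) ->
    exists2 i, (forall a, N a -> a *: i = 0) & g i = j.
  apply: (ideal_ind Rlen) => N Nid IH j Nj.
  have [N1|N1] := pselect (N 1).
    by exists 0; [move=> a _; rewrite scaler0 | rewrite linear0 -[RHS]scale1r Nj].
  have [b [Nb mb]] := exists_socle mloc Rart Nid N1; rewrite mulr1 in Nb mb.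
  (* The element [b j] is killed by [m], hence equals [s j'] with [s] in the socle of [R]. It lifts
     to [s i0], which [m] kills too. With [i1] killed by [N] and [b i1 = s i0], the difference
     [j - g i1] is killed by the larger ideal [N + R b]. *)
  have [|j' [_ j'E]] := ideal_injective_socle (p := b *: j) Jinj (zero_ideal R) s_neq0 ms.
    by move=> a ma; rewrite scalerA Nj //; apply: mb.
  have [i0 i0E] := gsurj j'.
  have [|i1 [Ni1 bi1]] := ideal_injective_socle (p := s *: i0) Iinj Nid Nb mb.
    by move=> a ma; rewrite scalerA; rewrite ms // scale0r.
  have gi1 : b *: (j - g i1) = 0.
    by rewrite scalerBr -linearZ_LR bi1 linearZ_LR i0E j'E subrr.
  have [||i2 N'i2 gi2] := IH _ (ideal_add_ideal b Nid) _ (j - g i1).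
  - split=> [a Na|sub]; first by exists a => //; exists 0; rewrite // mul0r addr0.
    by apply: Nb; apply: sub; exists 0; [apply: ideal0 | exists 1; rewrite // mul1r add0r].
  - move=> _ [a Na [t _ <-]]; rewrite scalerDl -scalerA gi1 scaler0 addr0.
    by rewrite scalerBr Nj // -linearZ_LR Ni1 // linear0 subr0.
  exists (i1 + i2); last by rewrite linearD gi2 addrC subrK.
  move=> a Na; rewrite scalerDr Ni1 // add0r; apply: N'i2.
  by exists a => //; exists 0; rewrite // mul0r addr0.
move=> N h Nid hlin.
have [|i iE] := Iinj N (f \o h) Nid.
  by move=> a u v Nu Nv /=; rewrite hlin // linearP.
(* [g i] is killed by [N]; subtracting a lift killed by [N] moves [i] into the image of [K] without
   changing its action on [N]. *)
have [|i' i'N i'E] := lift_killed N Nid (g i).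
  by move=> a Na; rewrite -linearZ_LR -iE //= gf.
have [k kE] : exists k, f k = i - i' by apply: fker; rewrite linearB i'E subrr.
exists k => a Na; apply: finj; rewrite linearZ_LR kE scalerBr i'N // subr0.
by rewrite -iE.
Qed.

Lemma injdim_ideal_injective n (K : lmodType R) : injdim_le n K -> ideal_injective K.
Proof.
elim: n K => [K|n IHn K]; first exact: injective_ideal_injective.
move=> [I [J [f [g [fg Iinj /IHn Jinj]]]]].
by apply: (ideal_injective_cosyzygy fg) => //; apply: injective_ideal_injective.
Qed.

Lemma gorenstein_socle (a b : R) : gorenstein R -> a <> 0 ->
  (forall r, m r -> r * a = 0) -> (forall r, m r -> r * b = 0) -> exists r, b = a * r.
Proof.
move=> [n /injdim_ideal_injective Rinj] a0 ma mb.
have [r [_ rE]] := @ideal_injective_socle R^o [set 0] a b Rinj (zero_ideal R) a0 ma mb.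
by exists r; rewrite -rE.
Qed.

(** Sending [a r] to [b r] is well defined on [R a], and by injectivity of [R] it is multiplication
    by some element. *)
Lemma gorenstein_annihilator (a b : R) : gorenstein R ->
  (forall r, r * a = 0 -> r * b = 0) -> exists r, b = a * r.
Proof.
move=> [n /injdim_ideal_injective Rinj] ab.
have /choice[c cP] : forall v, exists r, range ( *%R a) v -> v = a * r.
  move=> v; have [[r _ <-]|nv] := pselect (range ( *%R a) v); first by exists r.
  by exists 0 => /nv.
have cE v r : v = a * r -> c v * b = r * b.
  move=> vE; apply/eqP; rewrite -subr_eq0 -mulrBl; apply/eqP/ab.
  have -> : (c v - r) * a = a * c v - a * r by ring.
  by rewrite -vE -cP ?subrr //; exists r.
have [|k kP] := Rinj (range ( *%R a)) (fun v => c v * b) (range_mul_ideal a).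
  move=> e _ _ [u _ <-] [v _ <-]; rewrite (cE _ (e * u + v)); last by ring.
  by rewrite (cE (a * u) u) // (cE (a * v) v) // mulrDl -mulrA.
exists k; rewrite -[RHS]kP; last by exists 1; rewrite ?mulr1.
by rewrite (cE a 1) ?mulr1 ?mul1r.
Qed.

End InjectiveDimension.

(** * Stretched Gorenstein rings with nonprincipal maximal ideal *)

Section StretchedGorenstein.
Variables (R : comNzRingType) (m : set R) (l : nat).
Hypotheses (mloc : local_ring m) (Rart : artinian R) (Rlen : @has_length R R^o l).

Let mid : ideal m. Proof. exact: local_ideal mloc. Qed.

Lemma ideal_expS k : ideal_exp m k.+1 = ideal_mul m (ideal_exp m k).
Proof. by []. Qed.

Lemma ideal_exp_ideal k : ideal (ideal_exp m k).
Proof.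
case: k => [|k]; last exact: ideal_mul_ideal.
by apply/idealP.
Qed.

Lemma ideal_exp1 : ideal_exp m 1 = m.
Proof.
apply/seteqP; split.
  by apply: ideal_mul_sub => // a b ma _; apply: idealMr.
by move=> a ma; rewrite -[a]mulr1; apply: ideal_mul_mem.
Qed.

Lemma generated_by_principal (J : set R) k :
  (k < 2)%N -> @generated_by R R^o J k -> exists t, J = range ( *%R t).
Proof.
case: k => [|[|//]] _ [g <-].
  exists 0; apply/seteqP; split.
    apply: smallest_sub; first exact: range_mul_ideal.
    by move=> t [i _ _]; have := ltn_ord i.
  move=> _ [c _ <-]; rewrite mul0r.
  by apply: (ideal0 (I := span _)); apply: (@span_submodule R R^o).
exists (g ord0); rewrite -ideal_gen1.
suff -> : range g = [set g ord0] by [].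
by apply/seteqP; split=> [_ [i _ <-]|_ ->]; [rewrite [i]ord1 | exists ord0].
Qed.

(** Let [s = l - e]. If [m^2] were not principal, it would have length at least [s]: two for
    [m^2 / m^3] and one for each of the nonzero powers from [m^3] to [m^s]. Adding [e] for [m / m^2]
    and one for [R / m] exceeds [l]. *)
Lemma stretched_square e :
  @min_generators R R^o m e -> ideal_exp m (l - e) <> [set 0] ->
  exists t, ideal_exp m 2 = range ( *%R t).
Proof.
move=> [_ emin] ms; apply: contrapT => nprinc.
set s := (l - e)%N in ms.
have P2gen k : (k < 2)%N -> ~ @generated_by R R^o (ideal_exp m 2) k.
  by move=> lt2 /(generated_by_principal lt2).
have mgen k : (k < e)%N -> ~ @generated_by R R^o m k.
  by move=> ltke /emin; rewrite leqNgt ltke.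
have ngen0 J : J <> [set 0] -> forall k, (k < 1)%N -> ~ @generated_by R R^o J k.
  move=> J0 [|//] _ [g gJ]; apply: J0; rewrite -gJ; apply/seteqP; split.
    by apply: smallest_sub; [apply: zero_ideal | move=> t [i _ _]; have := ltn_ord i].
  move=> _ ->; apply: (ideal0 (I := span _)); exact: (@span_submodule R R^o).
have up p : long (ideal_exp m 2) p -> (p + e + 1 <= l)%N.
  move=> long2; apply: (long_length Rlen); rewrite addn1.
  have : long m (p + e) by apply: (long_generators mloc Rlen) => //; rewrite -[m in ideal_mul _ m]ideal_exp1.
  apply: longS; first by apply/idealP.
  by split=> // sub; apply: (local_not1 mloc); apply: sub.
have neq0 k : (k <= s)%N -> ideal_exp m k <> [set 0].
  move=> leks E; apply: ms; rewrite -(subnKC leks); elim: (s - k)%N => [|i IHi].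
    by rewrite addn0.
  rewrite addnS ideal_expS IHi; apply/seteqP; split; last first.
    by move=> _ ->; apply: ideal0; apply: ideal_mul_ideal.
  by apply: ideal_mul_sub; [apply: zero_ideal | move=> a b _ ->; rewrite mulr0].
have P2neq0 : ideal_exp m 2 <> [set 0].
  move=> E; apply: nprinc; exists 0; rewrite E; apply/seteqP; split=> [_ ->|_ [c _ <-]].
    by exists 0; rewrite ?mulr0.
  by rewrite mul0r.
have s_ge2 : (2 <= s)%N.
  have : long (ideal_exp m 2) (0 + 1).
    apply: (long_generators mloc Rlen); [exact: ideal_exp_ideal | exact: ngen0 |].
    by apply: long0; apply: ideal_mul_ideal.
  by move/up; rewrite /s; lia.
have long_exp i : (i <= s - 2)%N -> long (ideal_exp m (s.+1 - i)) i.
  elim: i => [_|i IHi lti]; first by apply: long0; apply: ideal_exp_ideal.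
  have d : (s.+1 - i = (s.+1 - i.+1).+1)%N by lia.
  suff : long (ideal_exp m (s.+1 - i.+1)) (i + 1) by rewrite addn1.
  apply: (long_generators mloc Rlen); first exact: ideal_exp_ideal.
    by apply: ngen0; apply: neq0; lia.
  by rewrite -ideal_expS -d; apply: IHi; lia.
have : long (ideal_exp m 2) (s - 2 + 2).
  apply: (long_generators mloc Rlen) P2gen _; first exact: ideal_exp_ideal.
  have d : (s.+1 - (s - 2) = 3)%N by lia.
  by have := long_exp (s - 2)%N (leqnn _); rewrite d.
by move/up; rewrite /s; lia.
Qed.

Hypothesis mnp : forall x, m <> range ( *%R x).
Hypothesis m2 : exists t, ideal_exp m 2 = range ( *%R t).
Let P2 := ideal_exp m 2.

Let P2id : ideal P2. Proof. exact: ideal_exp_ideal. Qed.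

Let P2E : P2 = ideal_mul m m. Proof. by rewrite /P2 ideal_expS ideal_exp1. Qed.

Let P2M a b : m a -> m b -> P2 (a * b). Proof. by rewrite P2E; apply: ideal_mul_mem. Qed.

(** If [b] generated [m] modulo [m^2], Nakayama's lemma would make [m] principal. *)
Lemma exists_generator_outside b : m b -> exists y, m y /\ ~ exists a c, P2 c /\ y = a * b + c.
Proof.
move=> mb; apply: contrapT => noy; apply: (mnp (x := b)); apply/seteqP; split; last first.
  by move=> _ [r _ <-]; apply: idealMr.
apply: (nakayama mloc Rlen mid (range_mul_ideal b)) => v mv.
have : exists a c, P2 c /\ v = a * b + c by apply: contrapT => nv; apply: noy; exists v.
move=> [a [c [P2c ->]]]; exists c, (a * b); rewrite addrC -P2E; split=> //.
by exists a; rewrite // mulrC.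
Qed.

(** If [m^2 = m^3], then [m^2 = 0]. Otherwise some product [a b] generates [m^2]; for [y]
    independent of [b] modulo [m^2], a multiple of [b] is subtracted from [y] so that [a] kills the
    difference. *)
Lemma exists_square_killer : exists w, [/\ m w, ~ P2 w & forall c, P2 c -> c * w = 0].
Proof.
have [all|] := pselect (forall a b, m a -> m b -> ideal_mul m P2 (a * b)).
  have P20 : P2 `<=` [set 0].
    apply: (nakayama mloc Rlen P2id (zero_ideal R)) => v; rewrite {1}P2E => Pv.
    exists v, 0; split=> //; last by rewrite addr0.
    by apply: ideal_mul_sub Pv => //; apply: ideal_mul_ideal.
  have [y [my ny]] := exists_generator_outside (ideal0 mid).
  exists y; split=> // [P2y|c /P20 ->]; last by rewrite mul0r.
  by apply: ny; exists 0, y; rewrite mul0r add0r.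
move=> /existsNP[a /existsNP[b /not_implyP[ma /not_implyP[mb nab]]]].
have [t tE] := m2.
have P2ab c : P2 c -> exists r, c = r * (a * b).
  have [u _ uE] : range ( *%R t) (a * b) by rewrite -tE; apply: P2M.
  have [v uv] : exists v, u * v = 1.
    apply: (local_unit mloc) => mu; apply: nab; rewrite -uE mulrC; apply: ideal_mul_mem => //.
    by rewrite /P2 tE; exists 1; rewrite ?mulr1.
  rewrite /P2 tE => -[r _ <-]; exists (v * r); rewrite -uE.
  have -> : v * r * (t * u) = (u * v) * (t * r) by ring.
  by rewrite uv mul1r.
have [y [my ny]] := exists_generator_outside mb.
have [c cE] := P2ab _ (P2M my ma).
exists (y - c * b); split.
- by apply: idealB => //; apply: idealMl.
- by move=> P2w; apply: ny; exists c, (y - c * b); split=> //; ring.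
- move=> d /P2ab[r ->].
  have -> : r * (a * b) * (y - c * b) = r * b * (y * a - c * (a * b)) by ring.
  by rewrite cE subrr mulr0.
Qed.

Hypothesis Rgor : gorenstein R.

(** What Tor requires of [z]: as [w z] is nonzero, elements of [R z] killed by [w] lie in [m z]; as
    [w] is outside [R z], some element kills [z] but not [w]. *)
Lemma exists_test_pair : exists w z,
  [/\ [/\ m w, m z & w <> 0], forall a b, m a -> m b -> a * (b * w) = 0, w * z <> 0 &
      ~ exists r, w = z * r].
Proof.
have [w [mw P2w wP2]] := exists_square_killer.
have w0 : w <> 0 by move=> w0; apply: P2w; rewrite w0; apply: (ideal0 P2id).
have mmw a b : m a -> m b -> a * (b * w) = 0.
  by move=> ma mb; rewrite mulrA wP2 //; apply: P2M.
have soc := gorenstein_socle mloc Rart Rlen Rgor.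
have unit_mul z r : m z -> w = z * r -> exists r', r * r' = 1.
  move=> mz wE; apply: (local_unit mloc) => mr; apply: P2w; rewrite wE.
  exact: P2M.
(* If [m w = 0], then [w] generates the socle, which is [m] when [m^2 = 0] and lies in [m^2]
   otherwise; both are excluded. *)
have [z0 [mz0 z0w]] : exists z, m z /\ z * w <> 0.
  apply: contrapT => noz.
  have mw0 r : m r -> r * w = 0 by move=> mr; apply: contrapT => rw; apply: noz; exists r.
  have [P20|] := pselect (forall c, P2 c -> c = 0).
    apply: (mnp (x := w)); apply/seteqP; split=> [v mv|_ [r _ <-]]; last exact: idealMr.
    have [|r ->] := soc w v w0 mw0; last by exists r.
    by move=> r mr; apply: P20; apply: P2M.
  move=> /existsNP[c /not_implyP[P2c c0]].
  have [r [rc mrc]] := exists_socle mloc Rart (zero_ideal R) c0.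
  have [s sE] := soc _ w rc mrc mw0.
  by apply: P2w; rewrite sE; apply: (idealMr P2id); apply: (idealMl P2id).
(* If [w] lies in [R z0], then [z0] is a unit times [w], and [w^2] is nonzero. So [z0] is shifted by
   some [v] with [w v = 0], independent of [w] modulo [m^2]. *)
have [[u wE]|] := pselect (exists r, w = z0 * r); last first.
  by exists w, z0; split=> //; rewrite mulrC.
have [u' uu'] := unit_mul _ _ mz0 wE.
have z0E : z0 = w * u' by rewrite wE -mulrA uu' mulr1.
have ww : w * w <> 0.
  move=> ww0; apply: z0w.
  by rewrite z0E mulrAC ww0 mul0r.
have [v0 [mv0 nv0]] := exists_generator_outside mw.
have [c cE] : exists c, v0 * w = w * w * c.
  by apply: soc => // r mr; apply: mmw.
pose v := v0 - c * w.
have vw : w * v = 0.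
  have -> : w * v = v0 * w - w * w * c by rewrite /v; ring.
  by rewrite cE subrr.
have mv : m v by apply: idealB => //; apply: idealMl.
have mz : m (z0 + v) by apply: idealD.
exists w, (z0 + v); split=> //.
  by rewrite mulrDr vw addr0 mulrC.
move=> [r wE']; have [r' rr'] := unit_mul _ _ mz wE'.
apply: nv0; exists (r' - u' + c), 0; split; first exact: ideal0.
have vE : v = w * r' - z0 by rewrite wE' -mulrA rr' mulr1 addrC addKr.
by rewrite addr0 -[LHS](subrK (c * w)) -/v vE z0E; ring.
Qed.

End StretchedGorenstein.

(** * Extension-closed subcategories defined by Tor *)

Section TorSubcategory.
Variables (R : comNzRingType) (w : R).
Implicit Types L M N : lmodType R.

Definition annihilator_span M : set M := span [set a *: v | a in [set a | a * w = 0] & v in setT].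

(* [Tor_1(M, R/w)] is [{v | w v = 0} / ann(w) M]. *)
Definition tor_vanishing M : Prop :=
  fin_gen M /\ forall v : M, w *: v = 0 -> annihilator_span v.

Let aspan_submodule M : submodule (@annihilator_span M). Proof. exact: span_submodule. Qed.

Let aspanP M := (submoduleP (@annihilator_span M)).1 (@aspan_submodule M).

Lemma annihilator_spanZ M a (v : M) : a * w = 0 -> annihilator_span (a *: v).
Proof. by move=> aw; apply: sub_gen_smallest; exists a => //; exists v. Qed.

Lemma annihilator_span_sub M (P : set M) : submodule P ->
  (forall a v, a * w = 0 -> P (a *: v)) -> @annihilator_span M `<=` P.
Proof. by move=> Psub Pa; apply: smallest_sub => // _ [a aw [v _ <-]]; apply: Pa. Qed.

Lemma annihilator_span_killed M (v : M) : annihilator_span v -> w *: v = 0.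
Proof.
apply: (annihilator_span_sub (P := [set v | w *: v = 0])) => [|a u aw] /=.
  apply/submoduleP; split=> [|a u u' wu wu'] /=; first by rewrite scaler0.
  by rewrite scalerDr scalerA mulrC -scalerA wu wu' scaler0 addr0.
by rewrite scalerA mulrC aw scale0r.
Qed.

Lemma annihilator_span_image M N (f : {linear M -> N}) (v : M) :
  annihilator_span v -> annihilator_span (f v).
Proof.
apply: (annihilator_span_sub (P := f @^-1` @annihilator_span N)) => [|a u aw].
  have [A0 AL] := aspanP N; apply/submoduleP; split; rewrite /preimage /=.
    by rewrite linear0.
  by move=> a u u' Au Au'; rewrite linearP; apply: AL.
by rewrite /preimage /= linearZ_LR; apply: annihilator_spanZ.
Qed.

Lemma annihilator_span_lift M N (f : {linear M -> N}) (v : N) :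
  (forall v, exists u, f u = v) -> annihilator_span v ->
  exists2 u, annihilator_span u & f u = v.
Proof.
move=> fsurj; have [A0 AL] := aspanP M.
apply: (annihilator_span_sub (P := [set v | exists2 u, annihilator_span u & f u = v])).
  apply/submoduleP; split=> /=; first by exists 0; rewrite ?linear0.
  move=> a _ _ [u Au <-] [u' Au' <-]; exists (a *: u + u'); last by rewrite linearP.
  exact: AL.
move=> a n aw /=; have [u <-] := fsurj n.
by exists (a *: u); [apply: annihilator_spanZ | rewrite linearZ_LR].
Qed.

Lemma tor_vanishing_extension_closed : extension_closed tor_vanishing.
Proof.
split.
- split; [by move=> M [] | exists (R^o : lmodType R) | ].
    split=> [|v wv]; last by rewrite -[v]mulr1; apply: annihilator_spanZ; rewrite mulrC.
    apply/fin_genP; exists [:: 1] => K /submoduleP[K0 KL] K1 v.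
    by rewrite -[v]mulr1 -[_ * _]addr0; apply: KL => //; apply: K1; rewrite inE.
  move=> M N [f fbij] [Mfin MT]; have [g fK gK] := fbij; split.
    by apply: fin_gen_image Mfin => v; exists (g v).
  move=> v wv; rewrite -[v]gK; apply: annihilator_span_image; apply: MT.
  by apply: (can_inj fK); rewrite linearZ_LR gK wv linear0.
- move=> M N [MNfin MNT].
  have [//|p pE] := @exists_linear R (M * N)%type M fst.
  have [//|q qE] := @exists_linear R (M * N)%type N snd.
  split; split.
  + by apply: (fin_gen_image (f := p)) MNfin => v; exists (v, 0); rewrite pE.
  + move=> v wv; have -> : v = p (v, 0) by rewrite pE.
    by apply: annihilator_span_image; apply: MNT; congr pair; rewrite /= ?scaler0.
  + by apply: (fin_gen_image (f := q)) MNfin => v; exists (0, v); rewrite qE.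
  + move=> v wv; have -> : v = q (0, v) by rewrite qE.
    by apply: annihilator_span_image; apply: MNT; congr pair; rewrite /= ?scaler0.
- move=> L M N f g Mfin [finj fg gT] [_ LT] [_ NT]; split=> // v wv.
  have gsurj n : exists u, g u = n by have [u _ <-] : range g n by [rewrite gT]; exists u.
  (* [w] kills the lift [u] of [g v], so [v - u] comes from an element of [L] killed by [w]. *)
  have [|u Au uE] := annihilator_span_lift gsurj (NT (g v) _).
    by rewrite -linearZ_LR wv linear0.
  have [k _ kE] : range f (v - u) by rewrite fg /preimage /= linearB uE subrr.
  have [A0 AL] := aspanP M.
  rewrite -[v](subrK u) -kE -[f k]scale1r; apply: AL => //.
  apply: annihilator_span_image; apply: LT; apply: finj.
  by rewrite linearZ_LR kE linear0 scalerBr wv (annihilator_span_killed Au) subrr.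
Qed.

End TorSubcategory.

Lemma trivial_maximal_ideal_principal (R : comNzRingType) (m : set R) (l : nat) :
  local_ring m -> artinian R -> @has_length R R^o l -> gorenstein R ->
  (exists t, ideal_exp m 2 = range ( *%R t)) ->
  only_trivial_extension_closed R -> exists x, m = range ( *%R x).
Proof.
move=> mloc Rart Rlen Rgor m2 triv; apply: contrapT => mnp'.
have mnp x : m <> range ( *%R x) by move=> E; apply: mnp'; exists x.
have mid := local_ideal mloc.
have [w [z [[mw mz w0] mmw wz0 nwz]]] := exists_test_pair mloc Rart Rlen mnp m2 Rgor.
have soc := gorenstein_socle mloc Rart Rlen Rgor.
have z0 : z <> 0 by move=> z0; apply: wz0; rewrite z0 mulr0.
have ann_m a b : a * b = 0 -> b <> 0 -> m a.
  move=> ab b0; apply: contrapT => /(local_unit mloc)[c ac]; apply: b0.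
  by rewrite -[b]mul1r -ac mulrAC ab mul0r.
pose M : lmodType R := @cyclic_submodule R R^o z.
have [e eE] : exists e : M, submodule_inj e = z.
  by apply: submodule_lift; exists 1 => //; apply: mul1r.
have MT : tor_vanishing w M.
  split=> [|v wv]; first exact: fin_gen_cyclic.
  have [r _ rv] := submodule_injP v.
  have wrz : w * (r * z) = 0.
    have /(congr1 submodule_inj) := wv; rewrite linearZ_LR linear0 -rv; exact.
  have mr : m r by apply: (ann_m _ (w * z)) => //; rewrite mulrCA.
  (* Both [r w] and [b w] lie in the socle, so [r w = b w c]. Then [r - b c] kills [w], and
     [(r - b c) z = r z] because [b z = 0]. *)
  have [b [bz bw]] : exists b, b * z = 0 /\ b * w <> 0.
    apply: contrapT => nob; apply: nwz.
    apply: (gorenstein_annihilator mloc Rart Rlen Rgor) => b bz.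
    by apply: contrapT => bw; apply: nob; exists b.
  have mb := ann_m _ _ bz z0.
  have [||c cE] := soc (b * w) (r * w) bw; do 1?[by move=> a ma; apply: mmw].
  have -> : v = (r - b * c) *: e.
    apply: submodule_inj_injective; rewrite linearZ_LR eE -rv.
    rewrite -[LHS]/(r * z) -[RHS]/((r - b * c) * z) mulrBl.
    by have -> : b * c * z = b * z * c by [ring]; rewrite bz mul0r subr0.
  apply: annihilator_spanZ; rewrite mulrBl cE.
  by have -> : b * c * w = b * w * c by [ring]; rewrite subrr.
have [s' [s0 ms]] := exists_socle mloc Rart (zero_ideal R) z0.
set s := s' * z in s0 ms.
case: (triv _ (tor_vanishing_extension_closed w)) => E.
- apply: z0; rewrite -eE ((E M).1 MT e); exact: linear0.
(* The nonzero socle element [s] kills [R z], as [z] is in [m]; a nonzero free module has no such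
   annihilator. *)
- have [[|d] [g [ggen gfree]]] := (fin_free_basis M).1 ((E M).1 MT).
    apply: z0; rewrite -eE; have [c ->] := ggen e; rewrite big_ord0; exact: linear0.
  apply: s0; pose c (j : 'I_d.+1) := if j == ord0 then s else 0.
  have /gfree/(_ ord0) : \sum_j c j *: g j = 0; last by rewrite /c eqxx.
  rewrite (bigD1 ord0) //= big1 ?addr0 /c => [|j /negbTE ->]; last by rewrite scale0r.
  rewrite eqxx; apply: submodule_inj_injective; rewrite linearZ_LR linear0.
  have [r _ <-] := submodule_injP (g ord0).
  by rewrite -[LHS]/(s * (r * z)) mulrCA [s * z]mulrC ms ?mulr0.
(* [K] is a copy of the residue field. Both [w] and its annihilator lie in [m] and kill [K], so the
   Tor module is [K] itself. *)
- pose K : lmodType R := @cyclic_submodule R R^o s.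
  have [k kE] : exists k : K, submodule_inj k = s.
    by apply: submodule_lift; exists 1 => //; apply: mul1r.
  have [_ KT] := (E K).2 (fin_gen_cyclic _).
  apply: s0; have <- : submodule_inj k = s by [].
  suff -> : k = 0 by apply: linear0.
  apply: (annihilator_span_sub (w := w) (P := [set v | v = 0])).
  + by apply/submoduleP; split=> // a _ _ -> ->; rewrite scaler0 addr0.
  + move=> a v aw /=; apply: submodule_inj_injective; rewrite linearZ_LR linear0.
    have [r _ <-] := submodule_injP v.
    by rewrite -[LHS]/(a * (r * s)) mulrCA ms ?mulr0 //; apply: ann_m aw w0.
  + apply: KT; apply: submodule_inj_injective; rewrite linearZ_LR linear0 kE.
    exact: ms.
Qed.

Theorem corollary2p9 (R : comNzRingType) (m : set R)
    (R_local : local_ring m) (R_noetherian : noetherian R)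
    (R_artinian : artinian R) (R_gorenstein : gorenstein R)
    (R_stretched : stretched m) :
  artinian_hypersurface R <-> only_trivial_extension_closed R.
Proof.
split=> [/hypersurface_chain_ring[x [n]]|triv]; first exact: chain_ring_only_trivial.
have [l [e [Rlen mgen ms]]] := R_stretched.
have m2 := stretched_square R_local Rlen mgen ms.
have [x mx] := trivial_maximal_ideal_principal R_local R_artinian Rlen R_gorenstein m2 triv.
have Rloc r : (exists s, r = x * s) \/ (exists s, r * s = 1).
  have [mr|/(local_unit R_local)] := pselect (m r); last by right.
  by left; move: mr; rewrite mx => -[s _ <-]; exists s.
have mX s : m (x * s) by rewrite mx; exists s.
(* The ideals [(x^i)] stabilize; [x^k = x^(k+1) s] forces [x^k = 0], because [1 - x s] is a unit. *)
have xnil : exists i, x ^+ i == 0.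
  have Iid i : ideal (range ( *%R (x ^+ i))) by apply: range_mul_ideal.
  have Isub i : range ( *%R (x ^+ i.+1)) `<=` range ( *%R (x ^+ i)).
    by move=> _ [s _ <-]; exists (x * s); rewrite // mulrA exprSr.
  have [k /(_ k.+1 (leqnSn k)) E] := R_artinian _ Iid Isub.
  have [s _ sE] : range ( *%R (x ^+ k.+1)) (x ^+ k) by rewrite E; exists 1; rewrite ?mulr1.
  exists k; apply/eqP; apply: (local_kill R_local (zero_ideal R) (mX s)).
  by rewrite /= mulrBl mul1r -[X in X - _]sE exprS; ring.
have [n /eqP xn nmin] := ex_minnP xnil.
by apply: (@chain_ring_hypersurface R x n); split=> // i /eqP; apply: nmin.
Qed.
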